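(* The following two conditions on $\mathcal{C}$ are equivalent: (1) For arbitrary objects $W_1,W_2,W_3,W_4,M_1$ of $\mathcal{C}$, arbitrary nonzero complex numbers $z_1,z_2$ satisfying $|z_1|>|z_2|>0$, and any $I_1\in\mathcal{M}[P(z_1)]_{W_1M_1}^{W_4}$ and $I_2\in\mathcal{M}[P(z_2)]_{W_2W_3}^{M_1}$, the product of $I_1$ and $I_2$ exists. (2) For arbitrary objects $W_1,W_2,W_3,W_4,M_2$ of $\mathcal{C}$, arbitrary nonzero complex numbers $z_0,z_2$ satisfying $|z_2|>|z_0|>0$, and any $I^1\in\mathcal{M}[P(z_2)]_{M_2W_3}^{W_4}$ and $I^2\in\mathcal{M}[P(z_0)]_{W_1W_2}^{M_2}$, the iterate of $I^1$ and $I^2$ exists.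
   Context: All vector spaces are over $\mathbb{C}$; $\mathbb{N}=\{0,1,2,\dots\}$, $\mathbb{C}^{\times}=\mathbb{C}\setminus\{0\}$. Symbols $x,x_0,x_1,\dots$ are commuting formal variables; $\delta(x)=\sum_{n\in\mathbb{Z}}x^n$; powers of a binomial are expanded in nonnegative integral powers of its second term. Vertex algebras. A Möbius vertex algebra is a $\mathbb{Z}$-graded space $V=\coprod_{n}V_{(n)}$ with vertex operators $Y(v,x)=\sum_{n\in\mathbb{Z}}v_nx^{-n-1}$, $v_n\in\mathrm{End}\,V$, linear in $v$, a vacuum $\mathbf{1}\in V_{(0)}$, and operators $L(-1),L(0),L(1)$ on $V$ with $[L(m),L(n)]=(m-n)L(m+n)$, such that: $u_nv=0$ for $n$ large; $Y(\mathbf 1,x)=1$; $Y(v,x)\mathbf 1\in V[[x]]$ has constant term $v$; the Jacobi identity $x_0^{-1}\delta(\frac{x_1-x_2}{x_0})Y(u,x_1)Y(v,x_2)-x_0^{-1}\delta(\frac{x_2-x_1}{-x_0})Y(v,x_2)Y(u,x_1)=x_2^{-1}\delta(\frac{x_1-x_0}{x_2})Y(Y(u,x_0)v,x_2)$; $L(0)v=nv$ for $v\in V_{(n)}$; $\frac{d}{dx}Y(v,x)=Y(L(-1)v,x)$; and $[L(j),Y(v,x)]=\sum_{i=0}^{j+1}\binom{j+1}{i}x^iY(L(j-i)v,x)$ for $j=-1,0,1$. It is conformal if there is $\omega\in V_{(2)}$ with $Y(\omega,x)=\sum_nL(n)x^{-n-2}$, the $L(n)$ satisfying the Virasoro relations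 and extending the given $L(0),L(\pm1)$. Standing assumption: $A\subset\tilde A$ are abelian groups, and $V$ is a strongly $A$-graded Möbius or conformal vertex algebra, i.e. $V=\coprod_{\alpha\in A}V^{(\alpha)}$ compatibly with the weight grading, $V^{(\alpha)}_{(n)}=V^{(\alpha)}\cap V_{(n)}$ is finite dimensional and is $0$ for $n$ sufficiently negative, $\mathbf 1\in V^{(0)}_{(0)}$, $v_lV^{(\beta)}\subset V^{(\alpha+\beta)}$ for $v\in V^{(\alpha)}$, $L(j)V^{(\alpha)}\subset V^{(\alpha)}$ for $j=0,\pm1$ (and $\omega\in V^{(0)}_{(2)}$ in the conformal case). Modules. A (strongly $\tilde A$-graded) generalized $V$-module is a space $W=\coprod_{n\in\mathbb{C}}W_{[n]}=\coprod_{\beta\in\tilde A}W^{(\beta)}$ (compatible gradings, $W^{(\beta)}_{[n]}=W^{(\beta)}\cap W_{[n]}$) with $Y_W(v,x)=\sum_nv_nx^{-n-1}$, $v_n\in\mathrm{End}\,W$, and operators $L(-1),L(0),L(1)$ on $W$ (the components of $Y_W(\omega,x)$ in the conformal case) satisfying the analogues on $W$ of truncation, vacuum, Jacobi, $\mathfrak{sl}(2)$, $L(-1)$-derivative and $L(j)$-bracket axioms, where $W_{[n]}$ is the generalized $L(0)$-eigenspace for $n$ (''generalized weight'' $n$), $v_lW^{(\beta)}\subset W^{(\alpha+\beta)}$ for $v\in V^{(\alpha)}$, $L(j)W^{(\beta)}\subset W^{(\beta)}$, $\dim W^{(\beta)}_{[n]}<\infty$, and $W^{(\beta)}_{[n+k]}=0$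 for fixed $n,\beta$ and $k\in\mathbb{Z}$ sufficiently negative. It is a $V$-module (ordinary) if $L(0)$ acts semisimply. Morphisms preserve all structure including the $\tilde A$-grading. The contragredient is $W'=\coprod_{\beta,n}(W^{(\beta)}_{[n]})^*$, with $(W')^{(\beta)}=\coprod_n(W^{(-\beta)}_{[n]})^*$, $\langle Y'(v,x)w',w\rangle=\langle w',Y_W(e^{xL(1)}(-x^{-2})^{L(0)}v,x^{-1})w\rangle$ and $\langle L'(j)w',w\rangle=\langle w',L(-j)w\rangle$. The formal completion is $\overline W=\prod_{n\in\mathbb{C}}W_{[n]}$, with projections $\pi_n:\overline W\to W_{[n]}$; it pairs with $W'$, the operators $v_n$, $L(j)$ extend to it, and $\overline{W^{(\beta)}}=\prod_nW^{(\beta)}_{[n]}$. Standing assumption on $\mathcal{C}$: $\mathcal{C}$ is a full subcategory of $\mathcal{M}_{sg}$ (strongly $\tilde A$-graded $V$-modules) or of $\mathcal{GM}_{sg}$ (strongly $\tilde A$-graded generalized $V$-modules), closed under contragredients and finite direct sums. $P(z)$-intertwining maps. Let $z\in\mathbb{C}^\times$ and let $W_1,W_2,W_3$ be generalized $V$-modules. $\mathcal{M}[P(z)]_{W_1W_2}^{W_3}$ is the space of $P(z)$-intertwining maps of type $\binom{W_3}{W_1W_2}$: linear maps $I:W_1\otimes W_2\to\overline{W_3}$ such that $I(W_1^{(\beta)}\otimes W_2^{(\gamma)})\subset\overline{W_3^{(\beta+\gamma)}}$; $\pi_{n-m}I(w_{(1)}\otimes w_{(2)})=0$ for $n\in\mathbb{C}$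 and $m\in\mathbb{N}$ sufficiently large; $x_0^{-1}\delta(\frac{x_1-z}{x_0})Y_3(v,x_1)I(w_{(1)}\otimes w_{(2)})=z^{-1}\delta(\frac{x_1-x_0}{z})I(Y_1(v,x_0)w_{(1)}\otimes w_{(2)})+x_0^{-1}\delta(\frac{z-x_1}{-x_0})I(w_{(1)}\otimes Y_2(v,x_1)w_{(2)})$; and $L(j)I(w_{(1)}\otimes w_{(2)})=I(w_{(1)}\otimes L(j)w_{(2)})+\sum_{i=0}^{j+1}\binom{j+1}{i}z^iI(L(j-i)w_{(1)}\otimes w_{(2)})$ for $j=-1,0,1$. Products and iterates. For $I_1\in\mathcal{M}[P(z_1)]_{W_1M_1}^{W_4}$, $I_2\in\mathcal{M}[P(z_2)]_{W_2W_3}^{M_1}$, the product of $I_1$ and $I_2$ exists if $\sum_{n\in\mathbb{C}}\langle w'_{(4)},I_1(w_{(1)}\otimes\pi_n(I_2(w_{(2)}\otimes w_{(3)})))\rangle$ converges absolutely for all $w_{(i)}\in W_i$ ($i=1,2,3$) and $w'_{(4)}\in W_4'$. For $I^1\in\mathcal{M}[P(z_2)]_{M_2W_3}^{W_4}$, $I^2\in\mathcal{M}[P(z_0)]_{W_1W_2}^{M_2}$, the iterate of $I^1$ and $I^2$ exists if $\sum_{n\in\mathbb{C}}\langle w'_{(4)},I^1(\pi_n(I^2(w_{(1)}\otimes w_{(2)}))\otimes w_{(3)})\rangle$ converges absolutely for all such vectors. *)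

(* Defs.v *)
From HB Require Import structures.
From mathcomp Require Import all_boot all_order all_algebra.
From mathcomp Require Import complex.
From mathcomp Require Import all_classical all_reals ereal esum.

Set Implicit Arguments.
Unset Strict Implicit.
Unset Printing Implicit Defensive.

Import Order.TTheory GRing.Theory Num.Theory.
Local Open Scope classical_set_scope.
Local Open Scope ring_scope.

(* The complex numbers are R[i] with R : realType.  Every formal-series
   identity is stated coefficientwise, with binomials expanded in nonnegative
   powers of their second term.  The sums \sum_(i \in A) of fsbigop are finite
   sums over the support of the summand; at each use below, the truncation and
   grading axioms make that support finite. *)

Section Gradings.
Variable R : realType.

(* U = \coprod_i U_i, given by its homogeneous projections. *)
Record grading (I : eqType) (U : lmodType R[i]) := Grading {
  gproj : I -> {linear U -> U};
  gprojE : forall i j u, gproj i (gproj j u) = if i == j then gproj j u else 0;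
  gproj_sum : forall u, exists s : seq I, uniq s /\ u = \sum_(i <- s) gproj i u
}.

Definition gpiece (I : eqType) (U : lmodType R[i]) (G : grading I U) (i : I)
  : set U := [set u | gproj G i u = u].

Definition bipiece (I J : eqType) (U : lmodType R[i])
    (G : grading I U) (H : grading J U) (i : I) (j : J) : set U :=
  gpiece G i `&` gpiece H j.

(* Each G-homogeneous subspace is the sum of its intersections with the
   H-homogeneous ones. *)
Definition compatible (I J : eqType) (U : lmodType R[i])
    (G : grading I U) (H : grading J U) : Prop :=
  forall i j u, gpiece G i u -> gpiece G i (gproj H j u).

Definition finite_dim (U : lmodType R[i]) (S : set U) : Prop :=
  exists (d : nat) (b : 'I_d -> U), (forall k, S (b k)) /\
    forall u, S u -> exists c : 'I_d -> R[i], u = \sum_k c k *: b k.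

End Gradings.

Section VertexAlgebras.
Variable R : realType.

Definition zbinom (m : int) (i : nat) : R[i] :=
  (\prod_(k < i) (m%:~R - k%:R)) / (i`!)%:R.

Record sl2_ops (U : lmodType R[i]) := Sl2Ops {
  opLm1 : {linear U -> U};
  opL0 : {linear U -> U};
  opL1 : {linear U -> U}
}.

(* L(j); only j = -1, 0, 1 is meaningful. *)
Definition Lop (U : lmodType R[i]) (L : sl2_ops U) (j : int) : {linear U -> U} :=
  if j == -1 then opLm1 L else if j == 0 then opL0 L
  else if j == 1 then opL1 L else \0.

Definition sl2_idx : seq int := [:: -1; 0; 1].

(* vaY v n is the operator v_n. *)
Record va_data := VaData {
  va_car :> lmodType R[i];
  vaY : va_car -> int -> {linear va_car -> va_car};
  vac : va_car;
  vaL : sl2_ops va_car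
}.

Section Action.
Variables (V : va_data) (W : lmodType R[i]).
Variables (Y : V -> int -> {linear W -> W}) (L : sl2_ops W).

Definition Y_linear : Prop := forall (a : R[i]) (u v : V) (n : int) (w : W),
  Y (a *: u + v) n w = a *: Y u n w + Y v n w.

Definition truncation : Prop := forall (v : V) (w : W),
  exists N : int, forall n : int, N <= n -> Y v n w = 0.

Definition vacuum : Prop := forall (n : int) (w : W),
  Y (vac V) n w = if n == -1 then w else 0.

(* Coefficient of x_0^(-l-1) x_1^(-m-1) x_2^(-n-1) of the Jacobi identity
   applied to w; on the side of Y(Y(u,x_0)v,x_2) the coefficient is
   (-1)^i binom(i-m-1,i) = binom(m,i). *)
Definition jacobi : Prop := forall (u v : V) (w : W) (l m n : int),
  \sum_(i \in [set: nat])
     ((-1) ^+ i * zbinom l i) *: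
       (Y u (l + m - i%:Z) (Y v (n + i%:Z) w)
        - (-1) ^ l *: Y v (l + n - i%:Z) (Y u (m + i%:Z) w))
  = \sum_(i \in [set: nat])
       zbinom m i *: Y (vaY u (l + i%:Z) v) (m + n - i%:Z) w.

Definition sl2_relations : Prop := forall (m n : int) (w : W),
  m \in sl2_idx -> n \in sl2_idx ->
  Lop L m (Lop L n w) - Lop L n (Lop L m w) = (m - n)%:~R *: Lop L (m + n) w.

(* d/dx Y(v,x) = Y(L(-1)v,x) *)
Definition L_derivative : Prop := forall (v : V) (n : int) (w : W),
  Y (Lop (vaL V) (-1) v) n w = (- n)%:~R *: Y v (n - 1) w.

(* [L(j),Y(v,x)] = \sum_(0 <= i <= j+1) binom(j+1,i) x^i Y(L(j-i)v,x) *)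
Definition L_bracket : Prop := forall (j : int) (v : V) (n : int) (w : W),
  j \in sl2_idx ->
  Lop L j (Y v n w) - Y v n (Lop L j w)
  = \sum_(i < `|(j + 1)%R|%N.+1)
      ('C(`|(j + 1)%R|, i))%:R *: Y (Lop (vaL V) (j - i%:Z) v) (n + i%:Z) w.

Record module_axioms : Prop := ModuleAxioms {
  ma_linear : Y_linear;
  ma_truncation : truncation;
  ma_vacuum : vacuum;
  ma_jacobi : jacobi;
  ma_sl2 : sl2_relations;
  ma_derivative : L_derivative;
  ma_bracket : L_bracket
}.

End Action.

(* Besides creation and grading, the axioms of a Moebius vertex algebra are the
   module axioms for V acting on itself. *)
Record moebius (V : va_data) (wt : grading int V) : Prop := Moebius {
  mo_self : module_axioms (@vaY V) (vaL V);
  mo_vac : gpiece wt 0 (vac V);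
  mo_creation : forall (v : V) (n : int), 0 <= n -> vaY v n (vac V) = 0;
  mo_creation_const : forall v : V, vaY v (-1) (vac V) = v;
  mo_weight : forall (n : int) (v : V),
    gpiece wt n v -> Lop (vaL V) 0 v = n%:~R *: v
}.

(* L(n) = omega_(n+1); c is the central charge. *)
Record conformal_vector (V : va_data) (wt : grading int V) (omega : V) : Prop :=
  ConformalVector {
  cv_weight : gpiece wt 2 omega;
  cv_L : forall (j : int) (v : V), j \in sl2_idx ->
    Lop (vaL V) j v = vaY omega (j + 1) v;
  cv_virasoro : exists c : R[i], forall (m n : int) (v : V),
    vaY omega (m + 1) (vaY omega (n + 1) v)
    - vaY omega (n + 1) (vaY omega (m + 1) v)
    = (m - n)%:~R *: vaY omega (m + n + 1) v
      + (if m + n == 0 then (m ^+ 3 - m)%:~R / 12%:R * c else 0) *: v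
}.

Record strong_grading (A : zmodType) (V : va_data)
    (wt : grading int V) (gr : grading A V) : Prop := StrongGrading {
  sg_compat : compatible gr wt;
  sg_fin : forall (a : A) (n : int), finite_dim (bipiece gr wt a n);
  sg_lower : forall a : A, exists N : int, forall n : int, n <= N ->
    forall v, bipiece gr wt a n v -> v = 0;
  sg_vac : gpiece gr 0 (vac V);
  sg_Y : forall (a b : A) (u v : V) (l : int),
    gpiece gr a u -> gpiece gr b v -> gpiece gr (a + b) (vaY u l v);
  sg_L : forall (a : A) (j : int) (v : V), j \in sl2_idx ->
    gpiece gr a v -> gpiece gr a (Lop (vaL V) j v)
}.

(* Strongly A-graded Moebius (va_conf = None) or conformal
   (va_conf = Some omega) vertex algebras. *)
Record vertex_algebra (A : zmodType) := VertexAlgebra {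
  va_dat :> va_data;
  va_wt : grading int va_dat;
  va_gr : grading A va_dat;
  va_conf : option va_dat;
  va_moebius : moebius va_wt;
  va_strong : strong_grading va_wt va_gr;
  va_conformal : forall omega, va_conf = Some omega ->
    conformal_vector va_wt omega /\ gpiece va_gr 0 omega
}.

End VertexAlgebras.

Section Modules.
Variables (R : realType) (A At : zmodType) (iota : {additive A -> At}).
Variable V : vertex_algebra R A.

(* Strongly At-graded generalized V-modules; iota : A -> At plays the role of
   the inclusion. *)
Record gmodule := GModule {
  gm_car :> lmodType R[i];
  gmY : V -> int -> {linear gm_car -> gm_car};
  gmL : sl2_ops gm_car;
  gm_wt : grading R[i] gm_car;
  gm_gr : grading At gm_car;
  gm_axioms : module_axioms gmY gmL;
  gm_conf : forall omega, va_conf V = Some omega ->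
    forall (j : int) (w : gm_car), j \in sl2_idx ->
    Lop gmL j w = gmY omega (j + 1) w;
  gm_weight : forall (n : R[i]) (w : gm_car),
    gpiece gm_wt n w <->
    exists k : nat, iter k (fun x => Lop gmL 0 x - n *: x) w = 0;
  gm_compat : compatible gm_gr gm_wt;
  gm_grY : forall (a : A) (b : At) (v : V) (l : int) (w : gm_car),
    gpiece (va_gr V) a v -> gpiece gm_gr b w ->
    gpiece gm_gr (iota a + b) (gmY v l w);
  gm_grL : forall (b : At) (j : int) (w : gm_car), j \in sl2_idx ->
    gpiece gm_gr b w -> gpiece gm_gr b (Lop gmL j w);
  gm_fin : forall (b : At) (n : R[i]), finite_dim (bipiece gm_gr gm_wt b n);
  gm_lower : forall (b : At) (n : R[i]), exists N : int, forall k : int,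
    k <= N -> forall w, bipiece gm_gr gm_wt b (n + k%:~R) w -> w = 0
}.

(* L(0) acts semisimply: generalized eigenvectors are eigenvectors. *)
Definition ordinary (W : gmodule) : Prop := forall (n : R[i]) (w : W),
  gpiece (gm_wt W) n w -> Lop (gmL W) 0 w = n *: w.

Definition GM_sg (W : gmodule) : Prop := True.
Definition M_sg (W : gmodule) : Prop := ordinary W.

Record morphism (W1 W2 : gmodule) (f : {linear W1 -> W2}) : Prop := Morphism {
  mor_Y : forall (v : V) (n : int) (w : W1), f (gmY W1 v n w) = gmY W2 v n (f w);
  mor_L : forall (j : int) (w : W1), j \in sl2_idx ->
    f (Lop (gmL W1) j w) = Lop (gmL W2) j (f w);
  mor_gr : forall (b : At) (w : W1),
    gpiece (gm_gr W1) b w -> gpiece (gm_gr W2) b (f w)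
}.

Definition direct_sum (d : nat) (Ws : 'I_d -> gmodule) (W : gmodule) : Prop :=
  exists inj : forall k, {linear Ws k -> W},
    (forall k, morphism (inj k)) /\
    forall w : W, exists! u : forall k, Ws k, w = \sum_k inj k (u k).

(* The underlying space of W', i.e. the direct sum over (b,n) of the duals of
   the W^(b)_[n], as a space of functionals on W. *)
Definition graded_dual (W : gmodule) (f : {scalar W}) : Prop :=
  exists s : seq (At * R[i]), forall (b : At) (n : R[i]) (w : W),
    (b, n) \notin s -> bipiece (gm_gr W) (gm_wt W) b n w -> f w = 0.

(* W' is the contragredient of W: the pairing identifies the vector space W'
   with the graded dual of W, and the structure of W' is the prescribed one.
   For v of weight h, the coefficient of x^(-m-1) in
   Y(e^(x L(1)) (-x^(-2))^(L(0)) v, x^(-1)) is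
   \sum_i (-1)^h / i! (L(1)^i v)_(2h-i-m-2). *)
Record contragredient (W W' : gmodule) (pair : W' -> {scalar W}) : Prop :=
  Contragredient {
  cg_linear : forall (a : R[i]) (f g : W') (w : W),
    pair (a *: f + g) w = a * pair f w + pair g w;
  cg_inj : forall f : W', (forall w, pair f w = 0) -> f = 0;
  cg_dual : forall f : W', graded_dual (pair f);
  cg_surj : forall g : {scalar W}, graded_dual g ->
    exists f : W', forall w, pair f w = g w;
  cg_gr : forall (b : At) (f : W'), gpiece (gm_gr W') b f <->
    (forall (c : At) (w : W), c != - b -> gpiece (gm_gr W) c w -> pair f w = 0);
  cg_wt : forall (n : R[i]) (f : W'), gpiece (gm_wt W') n f <->
    (forall (m : R[i]) (w : W), m != n -> gpiece (gm_wt W) m w -> pair f w = 0);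
  cg_Y : forall (h : int) (v : V) (m : int) (f : W') (w : W),
    gpiece (va_wt V) h v ->
    pair (gmY W' v m f) w =
    \sum_(i \in [set: nat]) ((-1) ^ h / (i`!)%:R) *
      pair f (gmY W (iter i (Lop (vaL V) 1) v) (h *+ 2 - i%:Z - m - 2) w);
  cg_L : forall (j : int) (f : W') (w : W), j \in sl2_idx ->
    pair (Lop (gmL W') j f) w = pair f (Lop (gmL W) (- j) w)
}.

(* A full subcategory is given by its class of objects.  Closure is up to
   isomorphism: a model of the contragredient, resp. of the direct sum of a
   nonempty finite family, lies in the class. *)
Record admissible (Cat : gmodule -> Prop) : Prop := Admissible {
  adm_full : (forall W, Cat W -> M_sg W) \/ (forall W, Cat W -> GM_sg W);
  adm_contragredient : forall W : gmodule, Cat W ->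
    exists (W' : gmodule) (pair : W' -> {scalar W}),
      Cat W' /\ contragredient pair;
  adm_direct_sum : forall (d : nat) (Ws : 'I_d.+1 -> gmodule),
    (forall k, Cat (Ws k)) -> exists W : gmodule, Cat W /\ direct_sum Ws W
}.

(* Elements of the formal completion \prod_n W_[n] are families f : R[i] -> W
   with f n in W_[n]; the projection pi_n is evaluation at n. *)
Definition completion (W : gmodule) : set (R[i] -> W) :=
  [set f | forall n, gpiece (gm_wt W) n (f n)].

Definition ext (W : gmodule) (T : W -> W) (f : R[i] -> W) : R[i] -> W :=
  fun m => \sum_(n \in [set: R[i]]) gproj (gm_wt W) m (T (f n)).

Definition cpair (W : gmodule) (w' : {scalar W}) (f : R[i] -> W) : R[i] :=
  \sum_(n \in [set: R[i]]) w' (f n).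

(* P(z)-intertwining maps of type (W3 ; W1 W2), as bilinear maps.  pi_jacobi is
   the coefficient of x_0^(-l-1) x_1^(-m-1), projected to the weight p. *)
Record intertwining (z : R[i]) (W1 W2 W3 : gmodule)
    (I : W1 -> W2 -> R[i] -> W3) : Prop := Intertwining {
  pi_linearl : forall (a : R[i]) (u v : W1) (w : W2) (n : R[i]),
    I (a *: u + v) w n = a *: I u w n + I v w n;
  pi_linearr : forall (a : R[i]) (w : W1) (u v : W2) (n : R[i]),
    I w (a *: u + v) n = a *: I w u n + I w v n;
  pi_completion : forall w1 w2, completion (I w1 w2);
  pi_grading : forall (b c : At) (w1 : W1) (w2 : W2) (n : R[i]),
    gpiece (gm_gr W1) b w1 -> gpiece (gm_gr W2) c w2 ->
    gpiece (gm_gr W3) (b + c) (I w1 w2 n);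
  pi_lower : forall (w1 : W1) (w2 : W2) (n : R[i]),
    exists N : nat, forall m : nat, (N <= m)%N -> I w1 w2 (n - m%:R) = 0;
  pi_jacobi : forall (v : V) (w1 : W1) (w2 : W2) (l m : int) (p : R[i]),
    \sum_(i \in [set: nat])
       (zbinom R l i * (- z) ^+ i) *: ext (gmY W3 v (l + m - i%:Z)) (I w1 w2) p
    = \sum_(i \in [set: nat])
         (zbinom R m i * z ^ (m - i%:Z)) *: I (gmY W1 v (l + i%:Z) w1) w2 p
      + \sum_(i \in [set: nat])
         ((-1) ^ l * (-1) ^+ i * zbinom R l i * z ^ (l - i%:Z)) *:
           I w1 (gmY W2 v (m + i%:Z) w2) p;
  pi_L : forall (j : int) (w1 : W1) (w2 : W2) (p : R[i]), j \in sl2_idx ->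
    ext (Lop (gmL W3) j) (I w1 w2) p
    = I w1 (Lop (gmL W2) j w2) p
      + \sum_(i < `|(j + 1)%R|%N.+1)
          (('C(`|(j + 1)%R|, i))%:R * z ^+ i) *:
            I (Lop (gmL W1) (j - i%:Z) w1) w2 p
}.

Definition abs_convergent (t : R[i] -> R[i]) : Prop :=
  summable [set: R[i]] (fun n => (complex.Re `|t n|)%:E).

Definition product_exists (W1 W2 W3 W4 M1 : gmodule)
    (I1 : W1 -> M1 -> R[i] -> W4) (I2 : W2 -> W3 -> R[i] -> M1) : Prop :=
  forall (w1 : W1) (w2 : W2) (w3 : W3) (w4' : {scalar W4}), graded_dual w4' ->
    abs_convergent (fun n => cpair w4' (I1 w1 (I2 w2 w3 n))).

Definition iterate_exists (W1 W2 W3 W4 M2 : gmodule)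
    (I1 : M2 -> W3 -> R[i] -> W4) (I2 : W1 -> W2 -> R[i] -> M2) : Prop :=
  forall (w1 : W1) (w2 : W2) (w3 : W3) (w4' : {scalar W4}), graded_dual w4' ->
    abs_convergent (fun n => cpair w4' (I1 (I2 w1 w2 n) w3)).

End Modules.

(* Main.v *)
(* Skew-symmetry exchanges products and iterates.  If [I] is a P(z)-intertwining
   map of type (W3; W1 W2), then [J w2 w1 := e^(-z L(-1)) (I w1 w2)] is a
   P(-z)-intertwining map of type (W3; W2 W1), because conjugation by
   [e^(-z L(-1))] turns [Y(v, x)] into [Y(v, x - z)].  The pairing of [I] with
   [w'] is that of [J] with [e^(z L'(1)) w'], which again lies in the graded dual.
   Hence the n-th term of the iterate of (I^1, I^2) at (z2, z0) is the n-th term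
   of the product of (J^1, I^2) at (-z2, z0), and symmetrically. *)

Require Import Defs.
From HB Require Import structures.
From mathcomp Require Import all_boot all_order all_algebra.
From mathcomp Require Import complex.
From mathcomp Require Import all_classical all_reals ereal esum.
From mathcomp Require Import ring zify.
Import Order.TTheory GRing.Theory Num.Theory.
Local Open Scope classical_set_scope.
Local Open Scope ring_scope.

Set Implicit Arguments.
Unset Strict Implicit.
Unset Printing Implicit Defensive.

(** No convergence is at stake in [e^(-z L(-1))] itself: [L(-1)] raises weights by 1 and [pi_lower]
    kills [I w1 w2] at [p - m] for large natural [m], so each weight component of the exponential is
    a finite sum. This finiteness shapes the proof. A vector of the completion is a bare family of
    components, and a sum of [fsbigop] over an infinite support is 0 by convention, so additivity
    and every exchange of sums need bounds that are uniform in the remaining indices. For the same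
    reason [v_n] is conjugated first for homogeneous [v], when it has a degree and [ext] reduces to
    one term; a general [v] is a finite sum of such vectors. On the dual side, [L'(1)] lowers
    weights, and [gm_lower] leaves only finitely many of the lowered pieces nonzero; hence the
    exponential of [L'(1)] preserves the graded dual. The pairings then agree for each intermediate
    weight separately, so absolute convergence is transported without any estimate, and the regions
    match because [-z] and [z] have the same modulus. *)

(** * Finitely supported sums and their exchange *)

Lemma fsbigT_seq (U : nmodType) (I : choiceType) (s : seq I) (F : I -> U) :
  uniq s -> (forall i, i \notin s -> F i = 0) ->
  \sum_(i \in [set: I]) F i = \sum_(i <- s) F i.
Proof.
move=> us F0; rewrite [RHS]fsbig_seq//; apply/esym.
by apply: fsbig_widen => // i [_ /= /negP]; apply: F0.
Qed.

Lemma fsbigT_ord (U : nmodType) (N : nat) (F : nat -> U) :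
  (forall i, (N <= i)%N -> F i = 0) ->
  \sum_(i \in [set: nat]) F i = \sum_(i < N) F i.
Proof.
move=> F0; rewrite fsbig_ord; apply/esym.
by apply: fsbig_widen => // i [_ /= /negP]; rewrite -leqNgt; apply: F0.
Qed.

Lemma fsbigT_single (U : nmodType) (I : choiceType) (j : I) (F : I -> U) :
  (forall i, i != j -> F i = 0) -> \sum_(i \in [set: I]) F i = F j.
Proof.
move=> F0; rewrite (@fsbigT_seq _ _ [:: j])// ?big_seq1// => i.
by rewrite inE => /F0.
Qed.

(** Terms beyond the antidiagonal [N] vanish, so the square may be summed along antidiagonals. This
    gives Cauchy products of truncated exponential series. *)
Lemma sum_triangle (U : nmodType) (N : nat) (F : nat -> nat -> U) :
  (forall i j, (N <= i + j)%N -> F i j = 0) ->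
  \sum_(i < N) \sum_(j < N) F i j
  = \sum_(n < N) \sum_(i < n.+1) F i (n - i)%N.
Proof.
move=> F0.
transitivity (\sum_(n < N) \sum_(i < N | (i <= n)%N) F i (n - i)%N); last first.
  apply: eq_bigr => n _.
  by rewrite [RHS](big_ord_widen_cond N predT (fun i => F i (n - i)%N)).
rewrite [RHS](exchange_big_dep predT)//=; apply: eq_bigr => i _.
rewrite -(big_mkord xpredT (F i)) -(big_mkord (leq i) (fun n => F i (n - i)%N)).
rewrite (@big_cat_nat _ _ _ (N - i)%N 0%N N)//= ?leq_subr// [X in _ + X]big_nat_cond.
rewrite [X in _ + X]big1 ?addr0 => [|j /andP[/andP[lij _] _]]; last first.
  by apply: F0; rewrite addnC -leq_subLR leq_subLR addnC -leq_subLR.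
rewrite (@big_cat_nat _ _ _ i 0%N N (leq i))//= ?(ltnW (ltn_ord i))//.
rewrite [X in _ = X + _]big_nat_cond [X in _ = X + _]big1 ?add0r; last first.
  by move=> j /andP[/andP[_ ji] ij]; rewrite leqNgt ji in ij.
have E k : \sum_(0 + k <= n < N | (k <= n)%N) F k (n - k)%N
         = \sum_(0 <= j < N - k) F k j.
  by rewrite big_addn; apply: eq_big => [j|j _]; rewrite ?leq_addl ?addnK.
exact/esym/(E i).
Qed.

Lemma uniform_bound (I : eqType) (s : seq I) (P : I -> nat -> Prop) :
  (forall i, i \in s -> exists N, forall m, (N <= m)%N -> P i m) ->
  exists N, forall i m, i \in s -> (N <= m)%N -> P i m.
Proof.
elim: s => [|i s IH] Ps; first by exists 0%N.
have [N N0] := Ps i (mem_head _ _).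
have [j js|M M0] := IH; first by apply: Ps; rewrite inE js orbT.
exists (maxn N M) => j m; rewrite inE geq_max => /orP[/eqP->|js] /andP[lNm lMm].
  exact: N0.
exact: M0.
Qed.

Lemma fsbigT_sum_single (U : nmodType) (H : Type) (I : choiceType) (s : seq H)
    (j : H -> I) (F : H -> I -> U) :
  (forall h i, i != j h -> F h i = 0) ->
  \sum_(i \in [set: I]) \sum_(h <- s) F h i = \sum_(h <- s) F h (j h).
Proof.
move=> F0; elim: s => [|h s IH].
  by rewrite big_nil; apply: fsbig1 => i _; rewrite big_nil.
(* [r] contains the supports of [F h] and of the sum over [s]; over this common finite list,
   addition is termwise. *)
pose r := undup (j h :: map j s).
have r0 i : i \notin r -> \sum_(h <- s) F h i = 0.
  rewrite mem_undup inE negb_or => /andP[_ ir]; elim: s {IH r} ir => [_|g s IHs].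
    by rewrite big_nil.
  by rewrite inE negb_or big_cons => /andP[/F0 -> /IHs ->]; rewrite addr0.
have rh i : i \notin r -> F h i = 0.
  by rewrite mem_undup inE negb_or => /andP[/F0].
rewrite big_cons -IH -(fsbigT_single (F0 h)).
rewrite !(@fsbigT_seq _ _ r) ?undup_uniq//.
  by rewrite -big_split; apply: eq_bigr => i _; rewrite big_cons.
by move=> i ir; rewrite big_cons rh// r0// addr0.
Qed.

(** * The exponential of an operator of degree 1 on lower truncated families *)

Section FormalExp.
Variables (K : numFieldType) (U : lmodType K).
Implicit Types (f g : K -> U) (p c : K).

Definition lower_truncated f : Prop :=
  forall p, exists N : nat, forall m : nat, (N <= m)%N -> f (p - m%:R) = 0.

Variable L : {linear U -> U}.

(* The component at [p] of [e^(cL) f], for an operator [L] of degree 1. *)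
Definition formal_exp c f p : U :=
  \sum_(k \in [set: nat]) (c ^+ k / k`!%:R) *: iter k L (f (p - k%:R)).

Lemma iter_linear0 k : iter k L 0 = 0.
Proof. by elim: k => //= k ->; rewrite linear0. Qed.

Lemma iter_linearP k a u v : iter k L (a *: u + v) = a *: iter k L u + iter k L v.
Proof. by elim: k => //= k ->; rewrite linearP. Qed.

Lemma iter_linear_sum k (I : Type) (s : seq I) (P : pred I) (F : I -> U) :
  iter k L (\sum_(i <- s | P i) F i) = \sum_(i <- s | P i) iter k L (F i).
Proof. by elim: k => //= k ->; rewrite linear_sum. Qed.

Lemma formal_expE N c f p :
  (forall m : nat, (N <= m)%N -> f (p - m%:R) = 0) ->
  formal_exp c f p = \sum_(k < N) (c ^+ k / k`!%:R) *: iter k L (f (p - k%:R)).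
Proof.
by move=> f0; apply: fsbigT_ord => i Ni; rewrite f0// iter_linear0 scaler0.
Qed.

Lemma eq_formal_exp c f g p :
  (forall k : nat, f (p - k%:R) = g (p - k%:R)) ->
  formal_exp c f p = formal_exp c g p.
Proof. by move=> fg; apply: eq_fsbigr => k _; rewrite fg. Qed.

Lemma lower_truncatedP a f g : lower_truncated f -> lower_truncated g ->
  lower_truncated (fun p => a *: f p + g p).
Proof.
move=> lf lg p; have [N N0] := lf p; have [M M0] := lg p.
exists (maxn N M) => m; rewrite geq_max => /andP[/N0-> /M0->].
by rewrite scaler0 addr0.
Qed.

Lemma lower_truncatedD f g : lower_truncated f -> lower_truncated g ->
  lower_truncated (fun p => f p + g p).
Proof.
move=> lf lg p; have [N N0] := lower_truncatedP 1 lf lg p; exists N => m /N0.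
by rewrite scale1r.
Qed.

Lemma lower_truncatedZ a f : lower_truncated f ->
  lower_truncated (fun p => a *: f p).
Proof. by move=> lf p; have [N N0] := lf p; exists N => m /N0 ->; rewrite scaler0. Qed.

Lemma lower_truncated_sum (I : eqType) (s : seq I) (F : I -> K -> U) :
  (forall i, i \in s -> lower_truncated (F i)) ->
  lower_truncated (fun p => \sum_(i <- s) F i p).
Proof.
elim: s => [_ p|i s IH lF p]; first by exists 0 => m _; rewrite big_nil.
have [M M0] := lF i (mem_head _ _) p.
have [j js|N N0] := IH _ p; first by apply: lF; rewrite inE js orbT.
exists (maxn N M) => m; rewrite geq_max => /andP[/N0 + /M0].
by rewrite big_cons => -> ->; rewrite addr0.
Qed.

Lemma lower_truncated_exp c f :
  lower_truncated f -> lower_truncated (formal_exp c f).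
Proof.
move=> lf p; have [N N0] := lf p; exists N => m Nm; apply: fsbig1 => k _.
by rewrite -addrA -opprD -natrD N0 ?iter_linear0 ?scaler0// (leq_trans Nm)// leq_addr.
Qed.

Lemma formal_expP c a f g p : lower_truncated f -> lower_truncated g ->
  formal_exp c (fun q => a *: f q + g q) p
  = a *: formal_exp c f p + formal_exp c g p.
Proof.
move=> lf lg; have [N N0] := lf p; have [M M0] := lg p.
have f0 (m : nat) : (maxn N M <= m)%N -> f (p - m%:R) = 0.
  by rewrite geq_max => /andP[/N0].
have g0 (m : nat) : (maxn N M <= m)%N -> g (p - m%:R) = 0.
  by rewrite geq_max => /andP[_ /M0].
rewrite (formal_expE _ f0) (formal_expE _ g0) (@formal_expE (maxn N M)); last first.
  by move=> m Nm; rewrite f0// g0// scaler0 addr0.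
rewrite scaler_sumr -big_split; apply: eq_bigr => k _ /=.
by rewrite iter_linearP scalerDr !scalerA [a * _]mulrC.
Qed.

Lemma formal_exp0 c p : formal_exp c (fun=> 0) p = 0.
Proof. by apply: fsbig1 => k _; rewrite iter_linear0 scaler0. Qed.

Lemma formal_exp_sum (I : eqType) (s : seq I) c (F : I -> K -> U) p :
  (forall i, i \in s -> lower_truncated (F i)) ->
  formal_exp c (fun q => \sum_(i <- s) F i q) p
  = \sum_(i <- s) formal_exp c (F i) p.
Proof.
elim: s => [_|i s IH lF].
  by rewrite big_nil -[RHS](formal_exp0 c p); apply: eq_formal_exp => k; rewrite big_nil.
have lFs j : j \in s -> lower_truncated (F j).
  by move=> js; apply: lF; rewrite inE js orbT.
rewrite big_cons -IH// -[formal_exp c (F i) p]scale1r -formal_expP.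
- by apply: eq_formal_exp => k; rewrite big_cons scale1r.
- by apply: lF; rewrite mem_head.
- exact: lower_truncated_sum.
Qed.

Lemma formal_expZ c a f p : lower_truncated f ->
  formal_exp c (fun q => a *: f q) p = a *: formal_exp c f p.
Proof.
move=> lf; rewrite -[RHS]addr0 -(formal_exp0 c p) -formal_expP//.
  by apply: eq_formal_exp => k; rewrite addr0.
by move=> ?; exists 0.
Qed.

Lemma lower_truncated_fsbig N (a : nat -> K) (G : nat -> K -> U) :
  (forall i, (N <= i)%N -> forall q, G i q = 0) ->
  (forall i, lower_truncated (G i)) ->
  lower_truncated (fun q => \sum_(i \in [set: nat]) a i *: G i q).
Proof.
move=> G0 lG q.
have /(_ q)[M M0] : lower_truncated (fun q => \sum_(i < N) a i *: G i q).
  apply: lower_truncated_sum => i _ r.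
  by have [M M0] := lG i r; exists M => m /M0 ->; rewrite scaler0.
exists M => m Mm; rewrite -[RHS](M0 m Mm).
by apply: fsbigT_ord => i Ni; rewrite G0// scaler0.
Qed.

Lemma formal_expD c f g p : lower_truncated f -> lower_truncated g ->
  formal_exp c (fun q => f q + g q) p = formal_exp c f p + formal_exp c g p.
Proof.
move=> lf lg; rewrite -[formal_exp c f p]scale1r -formal_expP//.
by apply: eq_formal_exp => k; rewrite scale1r.
Qed.

Lemma formal_exp_fsbig N c (a : nat -> K) (G : nat -> K -> U) p :
  (forall i, (N <= i)%N -> forall q, G i q = 0) ->
  (forall i, lower_truncated (G i)) ->
  formal_exp c (fun q => \sum_(i \in [set: nat]) a i *: G i q) p
  = \sum_(i \in [set: nat]) a i *: formal_exp c (G i) p.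
Proof.
move=> G0 lG.
rewrite (@eq_formal_exp c _ (fun q => \sum_(i < N) a i *: G i q)); last first.
  by move=> k; apply: fsbigT_ord => i Ni; rewrite G0// scaler0.
rewrite formal_exp_sum => [|i _]; last first.
  by move=> q; have [M M0] := lG i q; exists M => m /M0 ->; rewrite scaler0.
rewrite (@fsbigT_ord _ N) => [|i Ni]; last first.
  rewrite (@eq_formal_exp c _ (fun=> 0)) ?formal_exp0 ?scaler0// => k.
  exact: G0.
by apply: eq_bigr => i _; apply: formal_expZ.
Qed.

(** The terms of total degree n add up to [(c - c)^n / n!] times [L^n], by the binomial theorem, so
    only n = 0 survives. *)
Lemma formal_expN c f p : lower_truncated f ->
  formal_exp (- c) (formal_exp c f) p = f p.
Proof.
move=> lf; have [N N0] := lf p.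
(* The bound is made positive so that the term of degree 0 can be split off. *)
have {}N0 : forall m : nat, (N.+1 <= m)%N -> f (p - m%:R) = 0.
  by move=> m /ltnW/N0.
have E m : formal_exp c f (p - m%:R) =
    \sum_(k < N.+1) (c ^+ k / k`!%:R) *: iter k L (f (p - (m + k)%:R)).
  rewrite (@formal_expE N.+1) => [|k Nk].
    by apply: eq_bigr => k _; rewrite natrD opprD addrA.
  by rewrite -addrA -opprD -natrD N0// (leq_trans Nk)// leq_addl.
rewrite (@formal_expE N.+1) => [|m Nm]; last first.
  rewrite E big1// => k _.
  by rewrite N0 ?iter_linear0 ?scaler0// (leq_trans Nm)// leq_addr.
transitivity (\sum_(i < N.+1) \sum_(k < N.+1)
    ((- c) ^+ i / i`!%:R * (c ^+ k / k`!%:R)) *: iter (i + k) L (f (p - (i + k)%:R))).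
  apply: eq_bigr => i _; rewrite E iter_linear_sum scaler_sumr.
  apply: eq_bigr => k _; rewrite iterD.
  rewrite -[_ *: iter k _ _]addr0 iter_linearP iter_linear0 addr0.
  by rewrite scalerA.
rewrite (@sum_triangle _ _ (fun i k => ((- c) ^+ i / i`!%:R * (c ^+ k / k`!%:R))
   *: iter (i + k) L (f (p - (i + k)%:R)))); last first.
  by move=> i j Nij; rewrite N0// iter_linear0 scaler0.
rewrite big_ord_recl big_ord1 /= expr0 fact0 subr0 divr1 mul1r scale1r.
rewrite big1 ?addr0// => n _; rewrite /bump leq0n add1n.
rewrite (eq_bigr (fun i : 'I_n.+2 => (c ^+ (n.+1 - i) * (- c) ^+ i *+ 'C(n.+1, i))
    / n.+1`!%:R *: iter n.+1 L (f (p - n.+1%:R)))); last first.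
  move=> i _; have le_in : (i <= n.+1)%N by rewrite -ltnS.
  rewrite subnKC//; congr (_ *: _); rewrite -mulr_natr -(bin_fact le_in) !natrM.
  have h1 : 'C(n.+1, i)%:R != 0 :> K by rewrite pnatr_eq0 -lt0n bin_gt0.
  have h2 : i`!%:R != 0 :> K by rewrite pnatr_eq0 -lt0n fact_gt0.
  have h3 : (n.+1 - i)`!%:R != 0 :> K by rewrite pnatr_eq0 -lt0n fact_gt0.
  by field; rewrite h1 h2 h3.
by rewrite -scaler_suml -mulr_suml -exprDn subrr expr0n mul0r scale0r.
Qed.

(* [T k] plays the role of [ad(L)^k (T 0)]. *)
Lemma iter_comm (T : nat -> {linear U -> U}) (n : nat) u :
  (forall k u, L (T k u) - T k (L u) = T k.+1 u) ->
  iter n L (T 0%N u) = \sum_(k < n.+1) 'C(n, k)%:R *: T k (iter (n - k) L u).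
Proof.
move=> LT; have LTE k w : L (T k w) = T k.+1 w + T k (L w) by rewrite -LT subrK.
elim: n => [|n IH]; first by rewrite big_ord1 scale1r.
rewrite iterS IH linear_sum.
under eq_bigr => k _ do rewrite linearZ /= LTE scalerDr.
rewrite big_split /= [RHS]big_ord_recl /= bin0 ?subn0.
under [X in _ = _ + X]eq_bigr => k _ do rewrite /bump leq0n add1n binS natrD scalerDl subSS.
rewrite [X in _ = _ + X]big_split /= addrC addrA; congr (_ + _).
rewrite big_ord_recl /= bin0 ?subn0; congr (_ + _).
rewrite [RHS]big_ord_recr /= bin_small// scale0r addr0.
apply: eq_bigr => k _; rewrite /bump leq0n add1n.
by rewrite -iterS -subSn// subSS.
Qed.

(** This is [e^(cL) T = (e^(c ad L) T) e^(cL)]: Leibniz' rule [iter_comm], with ['C(n, k) / n!]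
    split as [1 / k!] times [1 / (n - k)!]. The shift [d] is the degree of [T 0], so [T k] has
    degree [d + k]. *)
Lemma formal_exp_comm (T : nat -> {linear U -> U}) c d f p :
  (forall k u, L (T k u) - T k (L u) = T k.+1 u) -> lower_truncated f ->
  formal_exp c (fun q => T 0%N (f (q - d))) p
  = \sum_(k \in [set: nat])
      (c ^+ k / k`!%:R) *: T k (formal_exp c f (p - d - k%:R)).
Proof.
move=> LT lf; have [N N0] := lf (p - d).
have E m : formal_exp c f (p - d - m%:R) =
    \sum_(k < N) (c ^+ k / k`!%:R) *: iter k L (f (p - d - (m + k)%:R)).
  rewrite (@formal_expE N) => [|k Nk].
    by apply: eq_bigr => k _; rewrite natrD opprD addrA.
  by rewrite -addrA -opprD -natrD N0// (leq_trans Nk)// leq_addl.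
rewrite (@fsbigT_ord _ N) => [|m Nm]; last first.
  rewrite E big1 ?linear0 ?scaler0// => k _.
  by rewrite N0 ?iter_linear0 ?scaler0// (leq_trans Nm)// leq_addr.
rewrite (@formal_expE N) => [|m Nm]; last by rewrite addrAC N0// linear0.
under [RHS]eq_bigr => k _.
  rewrite E linear_sum scaler_sumr.
  under eq_bigr => i _ do rewrite linearZ /= scalerA.
  over.
rewrite (@sum_triangle _ _ (fun k i => (c ^+ k / k`!%:R * (c ^+ i / i`!%:R)) *:
    T k (iter i L (f (p - d - (k + i)%:R))))); last first.
  by move=> i j Nij; rewrite N0// iter_linear0 linear0 scaler0.
apply: eq_bigr => n _; rewrite iter_comm// scaler_sumr; apply: eq_bigr => k _.
have le_kn : (k <= n)%N by rewrite -ltnS.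
rewrite scalerA subnKC// addrAC; congr (_ *: _).
have -> : c ^+ n = c ^+ k * c ^+ (n - k) by rewrite -exprD subnKC.
rewrite -(bin_fact le_kn) !natrM.
have h1 : 'C(n, k)%:R != 0 :> K by rewrite pnatr_eq0 -lt0n bin_gt0.
have h2 : k`!%:R != 0 :> K by rewrite pnatr_eq0 -lt0n fact_gt0.
have h3 : (n - k)`!%:R != 0 :> K by rewrite pnatr_eq0 -lt0n fact_gt0.
by field; rewrite h1 h2 h3.
Qed.

End FormalExp.

(** * Binomial coefficients with integer upper argument *)

Section Binomial.
Variable R : realType.

Lemma zbinom0 m : zbinom R m 0 = 1.
Proof. by rewrite /zbinom big_ord0 fact0 divr1. Qed.

Lemma zbinom0S i : zbinom R 0 i.+1 = 0.
Proof. by rewrite /zbinom big_ord_recl subr0 !mul0r. Qed.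

Lemma zbinomSr m i :
  zbinom R m i.+1 = zbinom R m i * (m%:~R - i%:R) / i.+1%:R.
Proof.
rewrite /zbinom big_ord_recr /= factS natrM.
have h1 : i.+1%:R != 0 :> R[i] by rewrite pnatr_eq0.
have h2 : i`!%:R != 0 :> R[i] by rewrite pnatr_eq0 -lt0n fact_gt0.
by field; rewrite h2 [1 + _]addrC -natr1 in h1 *; rewrite h1.
Qed.

Lemma zbinomS m i : zbinom R (m + 1) i.+1 = zbinom R m i.+1 + zbinom R m i.
Proof.
have -> : zbinom R (m + 1) i.+1 = zbinom R m i * (m%:~R + 1) / i.+1%:R.
  rewrite /zbinom big_ord_recl factS natrM subr0.
  under eq_bigr => k _ do rewrite lift0 -natr1 intrD mulr1z opprD addrACA subrr addr0.
  have h1 : i.+1%:R != 0 :> R[i] by rewrite pnatr_eq0.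
  have h2 : i`!%:R != 0 :> R[i] by rewrite pnatr_eq0 -lt0n fact_gt0.
  by rewrite intrD mulr1z; field; rewrite h2 [1 + _]addrC -natr1 in h1 *; rewrite h1.
rewrite zbinomSr.
have h1 : i.+1%:R != 0 :> R[i] by rewrite pnatr_eq0.
by field; rewrite [1 + _]addrC -natr1 in h1 *; rewrite h1.
Qed.

(* The coefficient of [t^j] in [(1 + t)^(l + m) (1 - t / (1 + t))^l = (1 + t)^m]. *)
Lemma zbinom_convolution l m j :
  \sum_(i < j.+1) (-1) ^+ i * zbinom R l i * zbinom R (l + m - i%:Z) (j - i)
  = zbinom R m j.
Proof.
pose F l := \sum_(i < j.+1)
  (-1) ^+ i * zbinom R l i * zbinom R (l + m - i%:Z) (j - i).
(* Pascal's rule on the first factor produces an extra sum with index shifted by one and opposite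
   sign; Pascal's rule on the second factor cancels it. The sum is thus independent of [l], and at
   [l = 0] only the term [i = 0] remains. *)
have step k : F (k + 1) = F k.
  rewrite {}/F; case: j => [|n]; first by rewrite !big_ord1 !zbinom0.
  rewrite big_ord_recl.
  under eq_bigr => i _ do rewrite lift0 zbinomS mulrDr mulrDl subSS.
  rewrite big_split /= addrA.
  set a := _ * _ * _; set b := (X in a + X + _).
  have -> : a + b = \sum_(i < n.+2) (-1) ^+ i * zbinom R k i *
      zbinom R (k + 1 + m - i%:Z) (n.+1 - i).
    by rewrite big_ord_recl /a !zbinom0.
  rewrite big_ord_recr [RHS]big_ord_recr /= subnn !zbinom0 addrAC; congr (_ + _).
  rewrite -big_split; apply: eq_bigr => i _ /=.
  have le_in : (i <= n)%N by rewrite -ltnS.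
  rewrite subSn// exprS.
  have -> : k + 1 + m - i%:Z = (k + m - i%:Z) + 1 by ring.
  have -> : k + 1 + m - i.+1%:Z = k + m - i%:Z by rewrite -addn1 PoszD; ring.
  by rewrite zbinomS; ring.
have F0 : F 0 = zbinom R m j.
  rewrite /F big_ord_recl subn0 subr0 big1 ?addr0 => [|i _].
    by rewrite zbinom0 !mul1r add0r.
  by rewrite lift0 zbinom0S mulr0 mul0r.
rewrite -F0 -[LHS]/(F l); case: l => n.
  by elim: n => // n <-; rewrite -addn1 PoszD step.
elim: n => [|n <-]; rewrite -step; congr F; lia.
Qed.

End Binomial.

(** * Functionals, signs and homogeneous components *)

Lemma scalar_of (K : numFieldType) (U : lmodType K) (F : U -> K) :
  scalar F -> exists g : {scalar U}, forall u, g u = F u.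
Proof.
move=> lF; pose mF := GRing.isLinear.Build _ _ _ _ F lF.
by exists (HB.pack_for {scalar U} F mF).
Qed.

Lemma exprzN_sub (F : fieldType) (z : F) (n : int) (i : nat) :
  (- z) ^ (n - i%:Z) = (-1) ^ n * (-1) ^+ i * z ^ (n - i%:Z).
Proof.
rewrite -[- z]mulN1r expfzMl; congr (_ * _).
rewrite expfzDr ?oppr_eq0 ?oner_eq0//; congr (_ * _).
by rewrite -exprnN -signr_odd; case: (odd i); rewrite ?expr1 ?expr0 ?invrN1 ?invr1.
Qed.

Section Gradings.
Variables (R : realType) (I : eqType) (U : lmodType R[i]) (G : grading I U).

Lemma gproj_piece i j u : gpiece G i u -> gproj G j u = if j == i then u else 0.
Proof. by move=> <-; rewrite gprojE; case: eqP => // ->. Qed.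

Lemma gpiece_gproj i u : gpiece G i (gproj G i u).
Proof. by rewrite /gpiece /= gprojE eqxx. Qed.

Lemma gpiece0 i : gpiece G i 0.
Proof. by rewrite /gpiece /= linear0. Qed.

Lemma gpieceZ i a u : gpiece G i u -> gpiece G i (a *: u).
Proof. by rewrite /gpiece /= linearZ => /= ->. Qed.

Lemma gpiece_sum i (J : Type) (s : seq J) (P : pred J) (F : J -> U) :
  (forall j, gpiece G i (F j)) -> gpiece G i (\sum_(j <- s | P j) F j).
Proof. by move=> GF; rewrite /gpiece /= linear_sum; apply: eq_bigr => j _; apply: GF. Qed.

End Gradings.

(** * Weights and conjugation by the exponential of [L(-1)] *)

Section Modules.
Variables (R : realType) (A At : zmodType) (iota : {additive A -> At}).
Variable V : vertex_algebra R A.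

Section Weights.
Variable W : gmodule iota V.
Local Notation wt := (gm_wt W).
Local Notation Y := (gmY W).
Local Notation L := (Lop (gmL W)).

(** [T] intertwines [L(0) - n] with [L(0) - (n + d)], hence also their powers; so it respects
    generalized eigenspaces, with no semisimplicity required. *)
Lemma weight_shift (T : {linear W -> W}) (d : R[i]) :
  (forall w, L 0 (T w) = T (L 0 w) + d *: T w) ->
  forall n w, gpiece wt n w -> gpiece wt (n + d) (T w).
Proof.
move=> LT n w /gm_weight[k kw]; apply/gm_weight; exists k.
have -> : iter k (fun x => L 0 x - (n + d) *: x) (T w)
        = T (iter k (fun x => L 0 x - n *: x) w).
  elim: k {kw} => //= k ->; set u := iter k _ w.
  rewrite LT [RHS]linearB [T (n *: u)]linearZ_LR [in LHS]scalerDl.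
  by rewrite [n *: _ + _]addrC opprD addrA addrK.
by rewrite kw linear0.
Qed.

Lemma weight_L j n w : j \in sl2_idx -> gpiece wt n w -> gpiece wt (n - j%:~R) (L j w).
Proof.
move=> js; apply: weight_shift => u.
have := ma_sl2 (gm_axioms W) u (isT : 0 \in sl2_idx) js.
by rewrite !add0r => /eqP; rewrite subr_eq addrC intrN => /eqP.
Qed.

Lemma Y_linearP a u v n w : Y (a *: u + v) n w = a *: Y u n w + Y v n w.
Proof. exact: (ma_linear (gm_axioms W)). Qed.

Lemma Y_0 n w : Y 0 n w = 0.
Proof.
have := Y_linearP (-1) 0 0 n w; rewrite scaler0 addr0 => ->.
by rewrite scaleN1r addNr.
Qed.

Lemma Y_sum (J : Type) (s : seq J) (F : J -> V) n w :
  Y (\sum_(j <- s) F j) n w = \sum_(j <- s) Y (F j) n w.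
Proof.
elim: s => [|j s IH]; first by rewrite !big_nil Y_0.
by rewrite !big_cons -IH -[F j]scale1r Y_linearP !scale1r.
Qed.

Lemma Y_Z a v n w : Y (a *: v) n w = a *: Y v n w.
Proof. by rewrite -[a *: v]addr0 Y_linearP Y_0 addr0. Qed.

(** The [L(0)]-bracket gives [[L(0), v_n] = (L(0)v)_n + (L(-1)v)_(n+1)], and the derivative axiom
    turns the last term into [-(n + 1) v_n]. *)
Lemma weight_Y (h n : int) v q w :
  gpiece (va_wt V) h v -> gpiece wt q w -> gpiece wt (q + (h - n - 1)%:~R) (Y v n w).
Proof.
move=> hv; apply: weight_shift => u.
have := ma_bracket (gm_axioms W) v n u (isT : 0 \in sl2_idx).
rewrite (_ : `|(0 + 1)%R|%N = 1%N)// big_ord_recl big_ord1 /=.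
rewrite (mo_weight (va_moebius V) hv).
rewrite (_ : 0 - (lift ord0 (ord0 : 'I_1))%:Z = -1)// (ma_derivative (gm_axioms W)).
rewrite scale1r Y_Z addr0 addrK scalerA.
move/eqP; rewrite subr_eq addrC => /eqP ->; congr (_ + _).
rewrite -scalerDl; congr (_ *: _).
rewrite (_ : bump 0 0 = 1%N)// bin1 mul1r -intrD; congr (_%:~R); lia.
Qed.

Lemma ext_homogeneous (T : {linear W -> W}) d (f : R[i] -> W) p :
  (forall q w, gpiece wt q w -> gpiece wt (q + d) (T w)) ->
  completion f -> ext T f p = T (f (p - d)).
Proof.
move=> Td cf; rewrite /ext (@fsbigT_single _ _ (p - d)) => [|i ip].
  by rewrite (gproj_piece _ (Td _ _ (cf _))) subrK eqxx.
rewrite (gproj_piece _ (Td _ _ (cf _))); case: eqP => // pE.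
by rewrite pE addrK eqxx in ip.
Qed.

Lemma ext_L j (f : R[i] -> W) p : j \in sl2_idx -> completion f ->
  ext (L j) f p = L j (f (p + j%:~R)).
Proof.
move=> js cf; rewrite (@ext_homogeneous _ (- j%:~R))// ?opprK// => q w.
exact: weight_L.
Qed.

Local Notation E := (formal_exp (L (- 1))).

(** Stated for an arbitrary [F], this and the next two lemmas unfold the bracket sum both for [I] at
    [z] and for [skew] at [-z]. *)
Lemma L_sum_m1 (y : R[i]) (U : lmodType R[i]) (F : W -> U) w :
  \sum_(i < `|(- 1 + 1)%R|%N.+1)
    (('C(`|(- 1 + 1)%R|, i))%:R * y ^+ i) *: F (L (- 1 - i%:Z) w)
  = F (L (- 1) w).
Proof. by rewrite big_ord1 bin0 mul1r expr0 scale1r subr0. Qed.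

Lemma L_sum_0 (y : R[i]) (U : lmodType R[i]) (F : W -> U) w :
  \sum_(i < `|(0 + 1)%R|%N.+1)
    (('C(`|(0 + 1)%R|, i))%:R * y ^+ i) *: F (L (0 - i%:Z) w)
  = F (L 0 w) + y *: F (L (- 1) w).
Proof.
by rewrite !big_ord_recl big_ord0 /= bin0 bin1 !mul1r expr0 expr1 scale1r !addr0.
Qed.

Lemma L_sum_1 (y : R[i]) (U : lmodType R[i]) (F : W -> U) w :
  \sum_(i < `|(1 + 1)%R|%N.+1)
    (('C(`|(1 + 1)%R|, i))%:R * y ^+ i) *: F (L (1 - i%:Z) w)
  = F (L 1 w) + ((y *+ 2) *: F (L 0 w)
    + y ^+ 2 *: F (L (- 1) w)).
Proof.
rewrite !big_ord_recl big_ord0 /= bin0 mul1r expr0 scale1r !addr0.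
by rewrite (mulr_natl y 2) mul1r.
Qed.

Lemma Lm1_comm j : j \in sl2_idx -> forall w, L (- 1) (L j w) - L j (L (- 1) w)
  = (- 1 - j)%:~R *: L (j - 1) w.
Proof. by move=> js w; rewrite (ma_sl2 (gm_axioms W))// [j - 1]addrC. Qed.

Lemma Y_comm v n w : L (- 1) (Y v n w) - Y v n (L (- 1) w) = (- n)%:~R *: Y v (n - 1) w.
Proof.
rewrite (ma_bracket (gm_axioms W))//.
rewrite (_ : `|(- 1 + 1 : int)%R|%N = 0%N)// big_ord1 bin0 scale1r.
by rewrite subr0 addr0 (ma_derivative (gm_axioms W)).
Qed.

Lemma ext_Y_homogeneous (h n : int) v (f : R[i] -> W) p : completion f ->
  gpiece (va_wt V) h v -> ext (Y v n) f p = Y v n (f (p - (h - n - 1)%:~R)).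
Proof. by move=> cf hv; apply: ext_homogeneous => // q w; apply: weight_Y. Qed.

Lemma ext_Y_decomposition v : exists s : seq (int * V),
  (forall x, x \in s -> gpiece (va_wt V) x.1 x.2) /\
  forall n (f : R[i] -> W) p, completion f ->
  ext (Y v n) f p = \sum_(x <- s) ext (Y x.2 n) f p.
Proof.
have [s [us vE]] := gproj_sum (va_wt V) v.
exists [seq (h, gproj (va_wt V) h v) | h <- s]; split.
  by move=> x /mapP[h _ ->]; apply: gpiece_gproj.
move=> n f p cf; rewrite big_map /ext.
transitivity (\sum_(q \in [set: R[i]]) \sum_(h <- s)
   gproj wt p (Y (gproj (va_wt V) h v) n (f q))).
  by apply: eq_fsbigr => q _; rewrite [in LHS]vE Y_sum linear_sum.
have E h q := gproj_piece p (weight_Y n (gpiece_gproj (va_wt V) h v) (cf q)).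
have E0 h q : q != p - (h - n - 1)%:~R ->
    gproj wt p (Y (gproj (va_wt V) h v) n (f q)) = 0.
  by rewrite E => qp; case: eqP => // pE; rewrite pE addrK eqxx in qp.
rewrite (fsbigT_sum_single _ E0).
by apply: eq_bigr => h _; rewrite (fsbigT_single (E0 h)).
Qed.

(** For [v] of weight [h] the left side reads [f] at [p - (h - n - 1) - (k + a)], which depends on
    [k + a] only. One bound thus gives lower truncation ([k = 0]) and finiteness of sums over [k]
    ([a = 0]). *)
Lemma ext_Y_truncated v n (f : R[i] -> W) p : completion f -> lower_truncated f ->
  exists N, forall k a : nat, (N <= k + a)%N -> ext (Y v (n - k%:Z)) f (p - a%:R) = 0.
Proof.
move=> cf lf; have [s [hs sE]] := ext_Y_decomposition v.
have [|N N0] := @uniform_bound _ s (fun x m => forall k a : nat, (k + a)%N = m ->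
    ext (Y x.2 (n - k%:Z)) f (p - a%:R) = 0).
  move=> x xs; have [M M0] := lf (p - (x.1 - n - 1)%:~R); exists M => m Mm k a kam.
  rewrite (ext_Y_homogeneous _ _ cf (hs _ xs)).
  have -> : p - a%:R - (x.1 - (n - k%:Z) - 1)%:~R = p - (x.1 - n - 1)%:~R - m%:R.
    by rewrite -kam natrD !rmorphB /=; ring.
  by rewrite M0// linear0.
exists N => k a Nka; rewrite sE// big_seq big1// => x xs.
exact: N0 Nka _ _ erefl.
Qed.

Lemma weight_iter m q w : gpiece wt q w -> gpiece wt (q + m%:R) (iter m (L (- 1)) w).
Proof.
move=> qw; elim: m => [|m IH]; first by rewrite addr0.
rewrite /= (_ : _ + m.+1%:R = q + m%:R - (- 1)%:~R); first exact: weight_L.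
by rewrite mulrN1z opprK -natr1 addrA.
Qed.

Lemma completion_exp c (f : R[i] -> W) :
  completion f -> lower_truncated f -> completion (E c f).
Proof.
move=> cf lf p; have [N N0] := lf p; rewrite (formal_expE _ _ N0).
apply: gpiece_sum => k; apply: gpieceZ.
rewrite -{1}[p](subrK k%:R); exact: weight_iter.
Qed.

Lemma exp_ext (T : nat -> {linear W -> W}) d c (f : R[i] -> W) p :
  (forall k q w, gpiece wt q w -> gpiece wt (q + (d + k%:R)) (T k w)) ->
  (forall k w, L (- 1) (T k w) - T k (L (- 1) w) = T k.+1 w) ->
  completion f -> lower_truncated f ->
  E c (ext (T 0%N) f) p
  = \sum_(k \in [set: nat]) (c ^+ k / k`!%:R) *: ext (T k) (E c f) p.
Proof.
move=> Td LT cf lf.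
rewrite (@eq_formal_exp _ _ _ c _ (fun q => T 0%N (f (q - d))) p); last first.
  by move=> k; rewrite (ext_homogeneous _ (Td 0%N) cf) addr0.
rewrite formal_exp_comm//; apply: eq_fsbigr => k _.
rewrite (ext_homogeneous _ (Td k)); first by rewrite opprD addrA.
exact: completion_exp.
Qed.

(** Coefficient of [x^(-n-1)] in [e^(cL(-1)) Y(v, x) = Y(v, x + c) e^(cL(-1))], since
    [binom(k-n-1, k) = (-1)^k binom(n, k)]. It comes from iterating [[L(-1), v_n] = -n v_(n-1)]. *)
Lemma exp_ext_Y v n c (f : R[i] -> W) p : completion f -> lower_truncated f ->
  E c (ext (Y v n) f) p = \sum_(k \in [set: nat])
    ((- c) ^+ k * zbinom R n k) *: ext (Y v (n - k%:Z)) (E c f) p.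
Proof.
move=> cf lf.
have cE := completion_exp c cf lf; have lE := lower_truncated_exp (L (-1)) c lf.
have lY u : lower_truncated (ext (Y u n) f).
  move=> q; have [N N0] := ext_Y_truncated u n q cf lf; exists N => m Nm.
  by rewrite -[n]subr0; apply: (N0 0%N).
have EY u q := ext_Y_truncated u n q cE lE.
have homog h u : gpiece (va_wt V) h u ->
    E c (ext (Y u n) f) p = \sum_(k \in [set: nat])
      ((- c) ^+ k * zbinom R n k) *: ext (Y u (n - k%:Z)) (E c f) p.
  move=> hu.
  (* [ad(L(-1))^k v_n = t k v_(n-k)] *)
  pose t k : R[i] := (-1) ^+ k * k`!%:R * zbinom R n k.
  pose T k : {linear W -> W} := t k \*: Y u (n - k%:Z).
  have -> : E c (ext (Y u n) f) p = E c (ext (T 0%N) f) p.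
    congr (E c (ext _ f) p); apply: funext => w.
    by rewrite /= /t zbinom0 !mul1r scale1r subr0.
  have wtT k q w : gpiece wt q w ->
      gpiece wt (q + ((h - n - 1)%:~R + k%:R)) (T k w).
    move=> qw; apply: gpieceZ.
    have -> : (h - n - 1)%:~R + k%:R = (h - (n - k%:Z) - 1)%:~R :> R[i].
      by rewrite !rmorphB /=; ring.
    exact: weight_Y.
  rewrite (@exp_ext _ (h - n - 1)%:~R)//.
    apply: eq_fsbigr => k _; rewrite (ext_homogeneous _ (wtT k) cE).
    rewrite (ext_Y_homogeneous _ _ cE hu) /= scalerA; congr (_ *: Y _ _ (E _ _ _)).
      rewrite /t [in RHS]exprNn.
      have h2 : k`!%:R != 0 :> R[i] by rewrite pnatr_eq0 -lt0n fact_gt0.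
      by field.
    by rewrite !rmorphB /=; ring.
  move=> k w; rewrite /= linearZ_LR -scalerBr Y_comm scalerA.
  rewrite (_ : n - k%:Z - 1 = n - k.+1%:Z); last by lia.
  congr (_ *: _); rewrite /t zbinomSr factS natrM exprS !rmorphN !rmorphB /=.
  have h1 : k.+1%:R != 0 :> R[i] by rewrite pnatr_eq0.
  by field; rewrite [1 + _]addrC -natr1 in h1 *; rewrite h1.
have [s [hs sE]] := ext_Y_decomposition v.
rewrite (@eq_formal_exp _ _ _ c _ (fun q => \sum_(x <- s) ext (Y x.2 n) f q) p); last first.
  by move=> k; rewrite sE.
rewrite formal_exp_sum//.
(* A bound common to all homogeneous components of [v] makes the sum over [k] finite, so that it can
   be exchanged with the sum over components. *)
have [|N N0] := @uniform_bound _ s (fun x m => ext (Y x.2 (n - m%:Z)) (E c f) p = 0).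
  move=> x xs; have [N N0] := EY x.2 p; exists N => m Nm.
  by rewrite -[p]subr0; apply: (N0 m 0%N); rewrite addn0.
rewrite (@fsbigT_ord _ N) => [|m Nm]; last first.
  by rewrite sE// big_seq big1 ?scaler0// => x xs; apply: N0.
under [RHS]eq_bigr do rewrite sE// scaler_sumr.
rewrite exchange_big /= big_seq [RHS]big_seq; apply: eq_bigr => x xs.
rewrite (homog _ _ (hs _ xs)); apply: fsbigT_ord => m Nm.
by rewrite N0// scaler0.
Qed.

(** For [L(j)] with [j = -1, 0, 1] the brackets [ad(L(-1))^k L(j)] vanish once [k > j + 1], so the
    conjugation series is a polynomial in [c]. In this and the next two proofs [T] lists these
    brackets. *)
Lemma exp_ext_Lm1 c (f : R[i] -> W) p : completion f -> lower_truncated f ->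
  E c (ext (L (- 1)) f) p = ext (L (- 1)) (E c f) p.
Proof.
move=> cf lf.
pose T k : {linear W -> W} := if k is 0%N then L (- 1) else \0.
rewrite (@exp_ext T 1)//.
- rewrite (@fsbigT_single _ _ 0%N) /= ?divr1 ?scale1r// => -[|k]// _.
  by rewrite /ext fsbig1 ?scaler0// => i _; rewrite linear0.
- move=> [|k] q w qw; last exact: gpiece0.
  by rewrite addr0 -[1]opprK -(mulrN1z 1); apply: weight_L.
- by move=> [|k] w /=; rewrite ?subrr// linear0 subr0.
Qed.

Lemma exp_ext_L0 c (f : R[i] -> W) p : completion f -> lower_truncated f ->
  E c (ext (L 0) f) p = ext (L 0) (E c f) p - c *: ext (L (- 1)) (E c f) p.
Proof.
move=> cf lf.
have cE := completion_exp c cf lf.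
pose T k : {linear W -> W} :=
  match k with 0%N => L 0 | 1%N => (- 1) \*: L (- 1) | _ => \0 end.
have wtT k q w : gpiece wt q w -> gpiece wt (q + (0 + k%:R)) (T k w).
  move=> qw; case: k => [|[|k]]; last exact: gpiece0.
    by rewrite !addr0 -[q]subr0; apply: weight_L.
  by rewrite add0r -[1%:R]opprK; apply: gpieceZ; apply: weight_L.
rewrite (@exp_ext T 0)//.
  rewrite (@fsbigT_ord _ 2); last first.
    move=> [|[|k]]// _.
    by rewrite /ext fsbig1 ?scaler0// => i _; rewrite linear0.
  rewrite big_ord_recl big_ord1 /= !divr1 expr0 expr1 scale1r; congr (_ + _).
  rewrite (ext_homogeneous _ (wtT 1%N) cE) /= scalerA mulrN1 scaleNr.
  by rewrite add0r ext_L.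
move=> [|[|k]] w /=; last by rewrite linear0 subrr.
  by rewrite Lm1_comm// subr0 scaleN1r.
by rewrite linearZ_LR subrr.
Qed.

Lemma exp_ext_L1 c (f : R[i] -> W) p : completion f -> lower_truncated f ->
  E c (ext (L 1) f) p = ext (L 1) (E c f) p - (c *+ 2) *: ext (L 0) (E c f) p
     + c ^+ 2 *: ext (L (- 1)) (E c f) p.
Proof.
move=> cf lf.
have cE := completion_exp c cf lf.
pose T k : {linear W -> W} := match k with
  0%N => L 1 | 1%N => (- 2%:R) \*: L 0 | 2%N => 2%:R \*: L (- 1) | _ => \0 end.
have wtT k q w : gpiece wt q w -> gpiece wt (q + (-1 + k%:R)) (T k w).
  move=> qw; case: k => [|[|[|k]]]; last exact: gpiece0.
  - by rewrite addr0; apply: weight_L.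
  - by rewrite addNr; apply: gpieceZ; rewrite -[0]oppr0; apply: weight_L.
  - rewrite (_ : -1 + 2%:R = - (-1)%:~R); last by rewrite mulrN1z; ring.
    by apply: gpieceZ; apply: weight_L.
rewrite (@exp_ext T (-1))//.
  rewrite (@fsbigT_ord _ 3); last first.
    move=> [|[|[|k]]]// _.
    by rewrite /ext fsbig1 ?scaler0// => i _; rewrite linear0.
  rewrite !big_ord_recl big_ord0 /= addr0 !divr1 expr0 scale1r addrA.
  congr (_ + _ + _).
    rewrite (ext_homogeneous _ (wtT 1%N) cE) /= scalerA addNr subr0.
    by rewrite ext_L// addr0 mulrN scaleNr mulr_natr.
  rewrite (ext_homogeneous _ (wtT 2%N) cE) /= scalerA ext_L//.
  congr (_ *: L _ (E _ _ _)); last by rewrite mulrN1z; ring.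
  by rewrite /bump /= !factS fact0 !muln1; field.
move=> [|[|[|k]]] w /=; last by rewrite linear0 subrr.
- by rewrite Lm1_comm.
- by rewrite linearZ_LR -scalerBr Lm1_comm// scalerA subr0 mulrN1z mulrNN mulr1.
- by rewrite linearZ_LR subrr.
Qed.

End Weights.

(** * The graded dual and the adjoint exponential *)

Section Dual.
Variable W : gmodule iota V.
Local Notation wt := (gm_wt W).
Local Notation L := (Lop (gmL W)).
Local Notation E := (formal_exp (L (- 1))).

(** Only finitely many weights occur in [w], and each equals [p - m] for at most one natural [m]. *)
Lemma lower_truncated_gproj (w : W) : lower_truncated (fun q => gproj wt q w).
Proof.
have [s [us wE]] := gproj_sum wt w; move=> p.
have w0 q : q \notin s -> gproj wt q w = 0.
  move=> qs; rewrite wE linear_sum big_seq big1// => x xs.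
  by rewrite gprojE; case: eqP qs => // ->; rewrite xs.
have [|N N0] := @uniform_bound _ s (fun x m => p - m%:R <> x).
  move=> x xs; have [[m <-]|npx] := pselect (exists m : nat, p - m%:R = x).
    exists m.+1 => k mk /addrI/oppr_inj/eqP; rewrite eqr_nat => /eqP km.
    by rewrite km ltnn in mk.
  by exists 0%N => m _ pm; apply: npx; exists m.
exists N => m Nm; apply: w0; apply/negP => ps.
exact: N0 ps Nm erefl.
Qed.

Lemma graded_dual_weights (w' : {scalar W}) : graded_dual w' ->
  exists T : seq R[i], uniq T /\
    forall n w, n \notin T -> gpiece wt n w -> w' w = 0.
Proof.
move=> [s s0]; exists (undup [seq x.2 | x <- s]); split; first exact: undup_uniq.
move=> n w; rewrite mem_undup => ns nw.
have [r [ur rE]] := gproj_sum (gm_gr W) w.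
rewrite rE linear_sum big1// => b _; apply: (s0 b n).
  by apply: contra ns => bs; apply/mapP; exists (b, n).
split; first exact: gpiece_gproj.
rewrite /gpiece /=.
(* [compatible] says that weight projections preserve degrees; the converse, that the degree
   components of [w] keep weight [n], has to be derived from it. *)
have comm c : gproj (gm_gr W) b (gproj wt n (gproj (gm_gr W) c w))
            = if b == c then gproj wt n (gproj (gm_gr W) c w) else 0.
  by apply: gproj_piece; apply: gm_compat; apply: gpiece_gproj.
have bE : gproj (gm_gr W) b w = gproj (gm_gr W) b (gproj wt n w) by rewrite nw.
have [bs|bs] := boolP (b \in r).
  rewrite [RHS]bE [in RHS]rE !linear_sum.
  rewrite (bigD1_seq b)//= comm eqxx big1 ?addr0// => c cb.
  by rewrite comm eq_sym (negPf cb).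
have -> : gproj (gm_gr W) b w = 0; last by rewrite linear0.
rewrite rE linear_sum big_seq big1// => c cs.
by rewrite gprojE; case: eqP bs => // ->; rewrite cs.
Qed.

(* [w''] is the functional [e^(c L'(1)) w']. *)
Lemma graded_dual_exp (c : R[i]) (w' : {scalar W}) : graded_dual w' ->
  exists w'' : {scalar W}, graded_dual w'' /\
    forall g : R[i] -> W, completion g -> lower_truncated g ->
      cpair w'' g = cpair w' (E c g).
Proof.
move=> dw'; have [T [uT T0]] := graded_dual_weights dw'.
have lg := lower_truncated_gproj.
(* A vector [w] enters the completion as the family of its weight components; [w'] sees the
   exponential of that family only at the weights in [T]. *)
have [|w'' w''E] := @scalar_of _ W (fun w => \sum_(p <- T) w' (E c (fun q => gproj wt q w) p)).
  move=> a u v; rewrite mulr_sumr -big_split; apply: eq_bigr => p _ /=.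
  rewrite (@eq_formal_exp _ _ _ c _ (fun q => a *: gproj wt q u + gproj wt q v)).
    by rewrite formal_expP// linearP.
  by move=> k; rewrite linearP.
exists w''; split.
  have [s s0] := dw'.
  have [|N N0] := @uniform_bound _ s (fun x k => forall w,
      bipiece (gm_gr W) wt x.1 (x.2 - k%:R) w -> w = 0).
    move=> [b n] _ /=; have [M M0] := @gm_lower _ _ _ _ _ W b n.
    exists `|M|%N => k Mk w bw; apply: (M0 (- k%:Z)); first by lia.
    by rewrite mulrNz.
  (* If [w] has weight [n], then [L(-1)^k w] has weight [n + k], so the support of [w''] consists of
     the pieces of [s] moved down by [k]. Those with [k >= N] are zero by [gm_lower]. *)
  exists [seq (x.1, x.2 - k%:R) | x <- s, k <- seq.iota 0 N] => b n w bn [bw nw].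
  rewrite w''E big1// => p _; have [M M0] := lg w p.
  rewrite (formal_expE _ _ M0) linear_sum big1// => k _; rewrite linearZ_LR.
  rewrite (gproj_piece _ nw); case: eqP => [pn|_]; last first.
    by rewrite iter_linear0 linear0 mulr0.
  have [bp|bp] := boolP ((b, p) \in s).
    have [kN|Nk] := ltnP k N.
      case/negP: bn; rewrite -pn; apply/allpairsP; exists ((b, p), nat_of_ord k).
      by rewrite mem_iota.
    rewrite (N0 _ _ bp Nk w); first by rewrite iter_linear0 linear0 mulr0.
    by rewrite /= pn.
  rewrite (s0 b p _ bp) ?mulr0//; split; last first.
    by rewrite -[p](subrK k%:R) pn; apply: weight_iter.
  by elim: (nat_of_ord k) => //= m IH; apply: gm_grL.
move=> g cg lw.
have [|K K0] := @uniform_bound _ T (fun p m => g (p - m%:R) = 0).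
  by move=> p _; apply: lw.
have w'E f : completion f -> cpair w' f = \sum_(p <- T) w' (f p).
  by move=> cf; apply: fsbigT_seq => // n nT; apply: T0 nT (cf n).
rewrite (w'E _ (completion_exp c cg lw)).
(* The pair [(p, k)] selects the contribution of [L(-1)^k] to weight [p], which uses [g n] for
   [n = p - k] alone. As [K] bounds [k] for every [p] in [T], the sum over [n] can be taken
   inside. *)
pose F (x : R[i] * nat) n :=
  w' ((c ^+ x.2 / x.2`!%:R) *: iter x.2 (L (- 1)) (gproj wt (x.1 - x.2%:R) (g n))).
transitivity (\sum_(n \in [set: R[i]])
    \sum_(x <- [seq (p, k) | p <- T, k <- index_iota 0 K]) F x n).
  apply: eq_fsbigr => n _; rewrite w''E big_allpairs [LHS]big_seq [RHS]big_seq.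
  apply: eq_bigr => p pT; rewrite (@formal_expE _ _ _ K); last first.
    move=> m Km; rewrite (gproj_piece _ (cg n)).
    by case: eqP => // <-; apply: K0.
  by rewrite linear_sum -(big_mkord xpredT (fun k => F (p, k) n)).
rewrite (@fsbigT_sum_single _ _ _ _ (fun x => x.1 - x.2%:R)); last first.
  move=> x n nx; rewrite /F (gproj_piece _ (cg n)) eq_sym (negPf nx).
  by rewrite iter_linear0 scaler0 linear0.
rewrite big_allpairs big_seq [RHS]big_seq; apply: eq_bigr => p pT.
rewrite (@formal_expE _ _ _ K) => [|m Km]; last exact: K0.
rewrite linear_sum -(big_mkord xpredT (fun k =>
  w' ((c ^+ k / k`!%:R) *: iter k (L (- 1)) (g (p - k%:R))))).
by apply: eq_bigr => k _; rewrite /F /= cg.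
Qed.

End Dual.

(** * Skew-symmetry of intertwining maps *)

Section Skew.
Variables (z : R[i]) (W1 W2 W3 : gmodule iota V) (I : W1 -> W2 -> R[i] -> W3).

Definition skew (w2 : W2) (w1 : W1) : R[i] -> W3 :=
  formal_exp (Lop (gmL W3) (- 1)) (- z) (I w1 w2).

Hypothesis zI : intertwining z I.

Let lI w1 w2 : lower_truncated (I w1 w2) := pi_lower zI w1 w2.
Let cI w1 w2 : completion (I w1 w2) := pi_completion zI w1 w2.

Lemma intertwining0l w2 n : I 0 w2 n = 0.
Proof.
have := pi_linearl zI (-1) 0 0 w2 n; rewrite scaler0 addr0 => ->.
by rewrite scaleN1r addNr.
Qed.

Lemma intertwining0r w1 n : I w1 0 n = 0.
Proof.
have := pi_linearr zI (-1) w1 0 0 n; rewrite scaler0 addr0 => ->.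
by rewrite scaleN1r addNr.
Qed.

Lemma skew_completion w2 w1 : completion (skew w2 w1).
Proof. exact: completion_exp. Qed.

Lemma skew_lower w2 w1 : lower_truncated (skew w2 w1).
Proof. exact: lower_truncated_exp. Qed.

Lemma formal_exp_skew w2 w1 p :
  formal_exp (Lop (gmL W3) (- 1)) z (skew w2 w1) p = I w1 w2 p.
Proof. by rewrite -{1}[z]opprK formal_expN. Qed.

(* This is [e^(-z L(-1)) delta((x1 - z)/x0) Y(v, x1) I = delta((x0 + z)/x1) Y(v, x0) J],
   up to normalization.  The right-hand sides of the Jacobi identities of [I] and
   [J] agree termwise once [x0] and [x1] are swapped. *)
Lemma skew_jacobi_lhs v l m w1 w2 p :
  formal_exp (Lop (gmL W3) (- 1)) (- z) (fun q => \sum_(i \in [set: nat])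
    (zbinom R m i * (- z) ^+ i) *: ext (gmY W3 v (m + l - i%:Z)) (I w1 w2) q) p
  = \sum_(i \in [set: nat]) (zbinom R l i * z ^+ i) *:
       ext (gmY W3 v (l + m - i%:Z)) (skew w2 w1) p.
Proof.
have [N N0] := ext_Y_truncated v (m + l) p (cI w1 w2) (lI w1 w2).
have [M M0] := ext_Y_truncated v (m + l) p (@skew_completion w2 w1) (@skew_lower w2 w1).
(* A single range must truncate both the family of [I] and that of [skew], so that the double sum
   below is a triangle. *)
set K := maxn N M.
have {}N0 k a : (K <= k + a)%N -> ext (gmY W3 v (m + l - k%:Z)) (I w1 w2) (p - a%:R) = 0.
  by rewrite geq_max => /andP[/N0].
have {}M0 k : (K <= k)%N -> ext (gmY W3 v (m + l - k%:Z)) (skew w2 w1) p = 0.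
  by rewrite geq_max => /andP[_ Mk]; rewrite -[p]subr0; apply: (M0 k 0%N); rewrite addn0.
have lY n : lower_truncated (ext (gmY W3 v n) (I w1 w2)).
  move=> q; have [Q Q0] := ext_Y_truncated v n q (cI w1 w2) (lI w1 w2).
  by exists Q => k Qk; rewrite -[n]subr0; apply: (Q0 0%N).
rewrite (@eq_formal_exp _ _ _ (- z) _ (fun q => \sum_(i < K) (zbinom R m i * (- z) ^+ i)
    *: ext (gmY W3 v (m + l - i%:Z)) (I w1 w2) q)); last first.
  move=> k; apply: fsbigT_ord => i Ki; rewrite N0 ?scaler0//.
  by rewrite (leq_trans Ki)// leq_addr.
rewrite formal_exp_sum => [|i _]; last first.
  by move=> q; have [Q Q0] := lY (m + l - i%:Z) q; exists Q => k /Q0 ->; rewrite scaler0.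
transitivity (\sum_(i < K) \sum_(k < K)
   (zbinom R m i * (- z) ^+ i * (z ^+ k * zbinom R (m + l - i%:Z) k)) *:
   ext (gmY W3 v (m + l - (i + k)%N%:Z)) (skew w2 w1) p).
  apply: eq_bigr => i _; rewrite formal_expZ// exp_ext_Y// opprK.
  rewrite (@fsbigT_ord _ K) => [|k Kk]; last first.
    rewrite (_ : _ - _ - _ = m + l - (i + k)%N%:Z); last by lia.
    by rewrite M0 ?scaler0// (leq_trans Kk)// leq_addl.
  rewrite scaler_sumr; apply: eq_bigr => k _; rewrite scalerA.
  by congr (_ *: ext (gmY W3 v _) _ _); lia.
rewrite (@sum_triangle _ K (fun i k =>
   (zbinom R m i * (- z) ^+ i * (z ^+ k * zbinom R (m + l - i%:Z) k)) *:
   ext (gmY W3 v (m + l - (i + k)%N%:Z)) (skew w2 w1) p)) => [|i k Kik]; last first.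
  by rewrite M0// scaler0.
rewrite (@fsbigT_ord _ K) => [|i Ki]; last by rewrite [l + m]addrC M0// scaler0.
(* On the antidiagonal [i + k = j] the powers of [z] combine to [(-1)^i z^j], leaving the
   convolution with [l] and [m] exchanged. *)
apply: eq_bigr => j _; rewrite -(zbinom_convolution R m) mulr_suml scaler_suml.
apply: eq_bigr => i _; have le_ij : (i <= j)%N by rewrite -ltnS.
rewrite subnKC// [m + l]addrC; congr (_ *: _).
have -> : z ^+ j = z ^+ i * z ^+ (j - i) by rewrite -exprD subnKC.
by rewrite [(- z) ^+ _]exprNn; ring.
Qed.

Lemma pi_Lm1 w1 w2 p : ext (Lop (gmL W3) (- 1)) (I w1 w2) p
  = I w1 (Lop (gmL W2) (- 1) w2) p + I (Lop (gmL W1) (- 1) w1) w2 p.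
Proof.
rewrite (pi_L zI)//; congr (_ + _).
exact: (L_sum_m1 z (fun u => I u w2 p)).
Qed.

Lemma pi_L0 w1 w2 p : ext (Lop (gmL W3) 0) (I w1 w2) p
  = I w1 (Lop (gmL W2) 0 w2) p +
    (I (Lop (gmL W1) 0 w1) w2 p + z *: I (Lop (gmL W1) (- 1) w1) w2 p).
Proof.
rewrite (pi_L zI)//; congr (_ + _).
exact: (L_sum_0 z (fun u => I u w2 p)).
Qed.

Lemma pi_L1 w1 w2 p : ext (Lop (gmL W3) 1) (I w1 w2) p
  = I w1 (Lop (gmL W2) 1 w2) p + (I (Lop (gmL W1) 1 w1) w2 p
    + ((z *+ 2) *: I (Lop (gmL W1) 0 w1) w2 p
    + z ^+ 2 *: I (Lop (gmL W1) (- 1) w1) w2 p)).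
Proof.
rewrite (pi_L zI)//; congr (_ + _).
exact: (L_sum_1 z (fun u => I u w2 p)).
Qed.

Lemma skew_Lm1 w1 w2 p : ext (Lop (gmL W3) (- 1)) (skew w2 w1) p
  = skew w2 (Lop (gmL W1) (- 1) w1) p + skew (Lop (gmL W2) (- 1) w2) w1 p.
Proof.
rewrite -exp_ext_Lm1// -formal_expD//.
by apply: eq_formal_exp => k; rewrite pi_Lm1 addrC.
Qed.

(** Moving the exponential past [L(0)] contributes [-z L(-1)], which acts on both arguments: on [w1]
    it cancels the term of [pi_L0], on [w2] it gives the term required at [-z]. The same
    cancellation, to second order, gives [skew_L1]. *)
Lemma skew_L0 w1 w2 p : ext (Lop (gmL W3) 0) (skew w2 w1) p
  = skew w2 (Lop (gmL W1) 0 w1) p + (skew (Lop (gmL W2) 0 w2) w1 p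
    + (- z) *: skew (Lop (gmL W2) (- 1) w2) w1 p).
Proof.
have := exp_ext_L0 (- z) p (cI w1 w2) (lI w1 w2).
rewrite -/(skew w2 w1) skew_Lm1.
have -> : ext (Lop (gmL W3) 0) (I w1 w2) = _ := funext (pi_L0 w1 w2).
have lZ := lower_truncatedZ z (lI (Lop (gmL W1) (- 1) w1) w2).
rewrite !formal_expD ?formal_expZ//; last exact: lower_truncatedD.
move/eqP; rewrite eq_sym subr_eq => /eqP ->.
by rewrite scalerDr !addrA scaleNr addrK [_ + skew w2 _ p]addrC.
Qed.

Lemma skew_L1 w1 w2 p : ext (Lop (gmL W3) 1) (skew w2 w1) p
  = skew w2 (Lop (gmL W1) 1 w1) p + (skew (Lop (gmL W2) 1 w2) w1 p
    + (((- z) *+ 2) *: skew (Lop (gmL W2) 0 w2) w1 p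
    + (- z) ^+ 2 *: skew (Lop (gmL W2) (- 1) w2) w1 p)).
Proof.
have := exp_ext_L1 (- z) p (cI w1 w2) (lI w1 w2).
rewrite -/(skew w2 w1) skew_L0 skew_Lm1.
have -> : ext (Lop (gmL W3) 1) (I w1 w2) = _ := funext (pi_L1 w1 w2).
have l0 := lower_truncatedZ (z *+ 2) (lI (Lop (gmL W1) 0 w1) w2).
have l1 := lower_truncatedZ (z ^+ 2) (lI (Lop (gmL W1) (- 1) w1) w2).
have l01 := lower_truncatedD l0 l1.
rewrite !formal_expD ?formal_expZ//; last exact: lower_truncatedD.
rewrite -!/(skew _ _); set X := ext _ _ _; set Y := (- z *+ 2) *: (_ + _).
set Z := (- z) ^+ 2 *: (_ + _) => H.
have -> : X = (X - Y + Z) - Z + Y by rewrite addrK subrK.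
rewrite -H {H}/Y /Z sqrrN mulNrn !scaleNr !scalerDr !scalerN scalerA.
have -> : z *+ 2 * z = z ^+ 2 + z ^+ 2 by rewrite mulrnAl mulr2n.
rewrite [(z ^+ 2 + z ^+ 2) *: _]scalerDl !opprD !opprK !addrA addrK.
set A1 := z ^+ 2 *: _; set A0 := (z *+ 2) *: skew _ w1 p; set B0 := (z *+ 2) *: _.
rewrite [_ - A1 - B0]addrAC addrK [_ - A1 - A0]addrAC subrK.
by rewrite [skew _ w1 p + _]addrC.
Qed.

Lemma skew_intertwining : intertwining (- z) skew.
Proof.
split.
- move=> a u v w1 n; rewrite /skew -formal_expP//.
  by apply: eq_formal_exp => k; rewrite (pi_linearr zI).
- move=> a w2 u v n; rewrite /skew -formal_expP//.
  by apply: eq_formal_exp => k; rewrite (pi_linearl zI).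
- exact: skew_completion.
- move=> b c w2 w1 n bw cw; have [N N0] := lI w1 w2 n.
  rewrite /skew (formal_expE _ _ N0); apply: gpiece_sum => k; apply: gpieceZ.
  move: (n - k%:R) => q; elim: (nat_of_ord k) => [|m IH] /=.
    by rewrite addrC; apply: (pi_grading zI).
  exact: gm_grL.
- exact: skew_lower.
- move=> v w2 w1 l m p.
  rewrite opprK -skew_jacobi_lhs.
  pose G1 i := I (gmY W1 v (m + i%:Z) w1) w2.
  pose G2 i := I w1 (gmY W2 v (l + i%:Z) w2).
  rewrite (@eq_formal_exp _ _ _ (- z) _ (fun q =>
    \sum_(i \in [set: nat]) (zbinom R l i * z ^ (l - i%:Z)) *: G1 i q +
    \sum_(i \in [set: nat])
      ((-1) ^ m * (-1) ^+ i * zbinom R m i * z ^ (m - i%:Z)) *: G2 i q)); last first.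
    by move=> k; apply: (pi_jacobi zI).
  (* Truncation of [v] on [w1] and on [w2] bounds [i] independently of the weight [q], as needed to
     pass the exponential through both sums. *)
  have [N N0] := ma_truncation (gm_axioms W1) v w1.
  have [M M0] := ma_truncation (gm_axioms W2) v w2.
  have G10 i : (`|N - m| <= i)%N -> forall q, G1 i q = 0.
    by move=> Ni q; rewrite /G1 N0 ?intertwining0l//; lia.
  have G20 i : (`|M - l| <= i)%N -> forall q, G2 i q = 0.
    by move=> Mi q; rewrite /G2 M0 ?intertwining0r//; lia.
  have lG1 i : lower_truncated (G1 i) by apply: lI.
  have lG2 i : lower_truncated (G2 i) by apply: lI.
  rewrite formal_expD; last 2 first.
  - exact: (lower_truncated_fsbig _ G10).
  - exact: (lower_truncated_fsbig _ G20).
  rewrite (formal_exp_fsbig _ _ _ _ G10)// (formal_exp_fsbig _ _ _ _ G20)// addrC.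
  congr (_ + _); apply: eq_fsbigr => i _; congr (_ *: _); rewrite exprzN_sub.
    by ring.
  (* The signs [(-1)^l (-1)^i] occur twice, once from the Jacobi identity and once from
     [(- z) ^ (l - i)], and cancel. *)
  have s2 : (-1) ^ l * (-1) ^ l = 1 :> R[i].
    by rewrite -expfzMl mulrNN mulr1 exp1rz.
  have s3 : (-1) ^+ i * (-1) ^+ i = 1 :> R[i].
    by rewrite -exprMn mulrNN mulr1 expr1n.
  move: ((-1) ^ l) ((-1) ^+ i) s2 s3 (zbinom _ _ _) (z ^ _) => s t s2 s3 x y.
  by transitivity (s * s * (t * t) * (x * y)); [rewrite s2 s3 !mul1r|ring].
- move=> j w2 w1 p js.
  move: js; rewrite !inE => /or3P[]/eqP->.
  - by rewrite skew_Lm1; congr (_ + _); apply/esym/(L_sum_m1 (- z) (fun u => skew u w1 p)).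
  - by rewrite skew_L0; congr (_ + _); apply/esym/(L_sum_0 (- z) (fun u => skew u w1 p)).
  - by rewrite skew_L1; congr (_ + _); apply/esym/(L_sum_1 (- z) (fun u => skew u w1 p)).
Qed.

Lemma cpair_skew w1 w2 (w' w'' : {scalar W3}) :
  (forall g : R[i] -> W3, completion g -> lower_truncated g ->
     cpair w'' g = cpair w' (formal_exp (Lop (gmL W3) (- 1)) z g)) ->
  cpair w'' (skew w2 w1) = cpair w' (I w1 w2).
Proof.
move=> wE; rewrite wE; [|exact: skew_completion|exact: skew_lower].
by congr (cpair w' _); apply: funext => p; apply: formal_exp_skew.
Qed.

End Skew.
End Modules.

(** * Equivalence of the two convergence conditions *)

Unset Implicit Arguments.

Theorem proposition7p3 (R : realType) (A At : zmodType)
    (iota : {additive A -> At}) (iota_inj : injective iota)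
    (V : vertex_algebra R A) (Cat : gmodule iota V -> Prop)
    (Cat_adm : admissible Cat) :
  (forall W1 W2 W3 W4 M1 : gmodule iota V,
     Cat W1 -> Cat W2 -> Cat W3 -> Cat W4 -> Cat M1 ->
   forall z1 z2 : R[i], z1 != 0 -> z2 != 0 ->
     `|z2| < `|z1| -> 0 < `|z2| ->
   forall (I1 : W1 -> M1 -> R[i] -> W4) (I2 : W2 -> W3 -> R[i] -> M1),
     intertwining z1 I1 -> intertwining z2 I2 -> product_exists I1 I2)
  <->
  (forall W1 W2 W3 W4 M2 : gmodule iota V,
     Cat W1 -> Cat W2 -> Cat W3 -> Cat W4 -> Cat M2 ->
   forall z0 z2 : R[i], z0 != 0 -> z2 != 0 ->
     `|z0| < `|z2| -> 0 < `|z0| ->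
   forall (I1 : M2 -> W3 -> R[i] -> W4) (I2 : W1 -> W2 -> R[i] -> M2),
     intertwining z2 I1 -> intertwining z0 I2 -> iterate_exists I1 I2).
Proof.
split=> H.
  move=> W1 W2 W3 W4 M2 C1 C2 C3 C4 CM z0 z2 z0n z2n lt02 z0p I1 I2 i1 i2.
  move=> w1 w2 w3 w4' dw4'; have [w [dw wE]] := graded_dual_exp z2 dw4'.
  have -> : (fun n => cpair w4' (I1 (I2 w1 w2 n) w3)) =
            (fun n => cpair w (skew z2 I1 w3 (I2 w1 w2 n))).
    by apply: funext => n; rewrite (cpair_skew i1 _ _ wE).
  (* The outer map now takes [W3] on the left and [M2] on the right, so the product involves [W3],
     [W1], [W2] in this order, at [-z2] and [z0]. *)
  apply: (H W3 W1 W2 W4 M2 _ _ _ _ _ (- z2) z0 _ _ _ _ (skew z2 I1) I2) => //.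
  - by rewrite oppr_eq0.
  - by rewrite normrN.
  - exact: skew_intertwining.
move=> W1 W2 W3 W4 M1 C1 C2 C3 C4 CM z1 z2 z1n z2n lt21 z2p I1 I2 i1 i2.
move=> w1 w2 w3 w4' dw4'; have [w [dw wE]] := graded_dual_exp z1 dw4'.
have -> : (fun n => cpair w4' (I1 w1 (I2 w2 w3 n))) =
          (fun n => cpair w (skew z1 I1 (I2 w2 w3 n) w1)).
  by apply: funext => n; rewrite (cpair_skew i1 _ _ wE).
(* Here [W1] moves to the right: the iterate involves [W2], [W3], [W1], with inner point [z2] and
   outer point [-z1]. *)
apply: (H W2 W3 W1 W4 M1 _ _ _ _ _ z2 (- z1) _ _ _ _ (skew z1 I1) I2) => //.
- by rewrite oppr_eq0.
- by rewrite normrN.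
- exact: skew_intertwining.
Qed.
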